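(* Let $\Omega$ be a nonempty set and let $(A,\rho_\Omega)$ be an $\Omega$-operated $\mathbf{k}$-algebra. Let $B$ be a $\mathbf{k}$-augmented algebra and let $i_B:B\hookrightarrow\mathfrak{I}(\Omega,A\otimes B)$ be the natural injection. The pair $(\mathfrak{I}(\Omega,A\otimes B),\Pi_\Omega)$ together with $i_B$ is the free $(A,\rho_\Omega)$-algebra over $B$.
   Context: $\mathbf{k}$ is a field of characteristic $0$; all algebras are commutative unital $\mathbf{k}$-algebras (except the augmentation parts $B^+$ etc. below, which need not have a unit), and tensor products are over $\mathbf{k}$. An $\Omega$-operated $\mathbf{k}$-algebra is a $\mathbf{k}$-algebra $V$ with $\mathbf{k}$-linear maps $P_\omega:V\to V$, $\omega\in\Omega$; write $P_\Omega=(P_\omega\mid\omega\in\Omega)$. A homomorphism $(V,P_\Omega)\to(U,Q_\Omega)$ is an algebra homomorphism $f$ with $fP_\omega=Q_\omega f$ for all $\omega$. For an $\Omega$-operated algebra $(A,\rho_\Omega)$, an $(A,\rho_\Omega)$-algebra is an $\Omega$-operated algebra $(R,P_\Omega)$ with a homomorphism $j_R:(A,\rho_\Omega)\to(R,P_\Omega)$ of $\Omega$-operated algebras (structure map). A homomorphism $f:(R,P_\Omega)\to(S,Q_\Omega)$ of $(A,\rho_\Omega)$-algebras is a homomorphism of $\Omega$-operated algebras with $fj_R=j_S$. $B$ is $\mathbf{k}$-augmented if $B=\mathbf{k}\oplus B^+$ as a direct sum of $\mathbf{k}$-subalgebras ($B^+$ not required unital). The free $(A,\rho_\Omega)$-algebra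 over $B$ is an $(A,\rho_\Omega)$-algebra $(F,\Pi_\Omega)$ with an algebra homomorphism $i_B:B\to F$ such that for any $(A,\rho_\Omega)$-algebra $(R,P_\Omega)$ and algebra homomorphism $f:B\to R$ there is a unique $(A,\rho_\Omega)$-algebra homomorphism $\bar f:(F,\Pi_\Omega)\to(R,P_\Omega)$ with $\bar f\,i_B=f$. Construction of $\mathfrak{I}(\Omega,A\otimes B)$. For a module $V$, $\lfloor V\rfloor_\omega$ is a copy of $V$ with linear bijection $v\mapsto\lfloor v\rfloor_\omega$, and $\lfloor V\rfloor_\Omega:=\bigoplus_{\omega\in\Omega}\lfloor V\rfloor_\omega$. $S(V)=\bigoplus_{n\ge0}S^n(V)$ is the symmetric algebra, $S^+(V)=\bigoplus_{n\ge1}S^n(V)$. Put $C:=A\otimes B=A\oplus C_A^+$ with $C_A^+:=A\otimes B^+$ (and $A$ identified with $A\otimes1$). Set $\mathfrak{I}_0:=C$, $\mathfrak{I}_0^+:=C_A^+$, and for $n\ge0$ $$\mathfrak{I}_{n+1}:=C\otimes S(\lfloor\mathfrak{I}_n^+\rfloor_\Omega)=A\oplus\mathfrak{I}_{n+1}^+,\qquad \mathfrak{I}_{n+1}^+:=C_A^+\oplus\big(C\otimes S^+(\lfloor\mathfrak{I}_n^+\rfloor_\Omega)\big).$$ The inclusions $\mathfrak{I}_0\hookrightarrow\mathfrak{I}_1$ ($c\mapsto c\otimes1$), $\mathfrak{I}_0^+\hookrightarrow\mathfrak{I}_1^+$ induce recursively algebra injections $\mathfrak{I}_n\hookrightarrow\mathfrak{I}_{n+1}$,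 $\mathfrak{I}_n^+\hookrightarrow\mathfrak{I}_{n+1}^+$. Define $\mathfrak{I}=\mathfrak{I}(\Omega,A\otimes B):=\varinjlim\mathfrak{I}_n=\bigcup_n\mathfrak{I}_n$ and $\mathfrak{I}^+:=\bigcup_n\mathfrak{I}_n^+$, so $\mathfrak{I}=A\oplus\mathfrak{I}^+$. For $\omega\in\Omega$, $\Pi_\omega:\mathfrak{I}\to\mathfrak{I}$ is the linear map with $\Pi_\omega(u)=\rho_\omega(u)$ for $u\in A$ and $\Pi_\omega(u)=\lfloor u\rfloor_\omega$ for $u\in\mathfrak{I}^+$; $\Pi_\Omega=(\Pi_\omega\mid\omega\in\Omega)$. The structure map is the inclusion $A\hookrightarrow\mathfrak{I}$, and $i_B(b)=1\otimes b\in\mathfrak{I}_0$. *)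

(* Defs.v *)
From HB Require Import structures.
From mathcomp Require Import all_boot all_algebra.
From mathcomp Require Import boolp classical_sets functions cardinality.

Set Implicit Arguments.
Unset Strict Implicit.
Unset Printing Implicit Defensive.

Import GRing.Theory.
Local Open Scope ring_scope.
Local Open Scope quotient_scope.
Local Open Scope classical_set_scope.

(* Commutative unital k-algebras. This is the comAlgType of ssralg without the *)
(* condition 1 != 0: the zero algebra is allowed.                             *)
Record comAlg (k : pzRingType) := ComAlg {
  comAlg_mod : lmodType k;
  comAlg_one : comAlg_mod;
  comAlg_mul : comAlg_mod -> comAlg_mod -> comAlg_mod;
  comAlg_mulA : associative comAlg_mul;
  comAlg_mulC : commutative comAlg_mul;
  comAlg_mul1 : left_id comAlg_one comAlg_mul;
  comAlg_mulDl : left_distributive comAlg_mul +%R;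
  comAlg_scalel : forall (c : k) (u v : comAlg_mod),
    c *: comAlg_mul u v = comAlg_mul (c *: u) v
}.

Definition comAlg_sort (k : pzRingType) (A : comAlg k) : Type := comAlg_mod A.
Coercion comAlg_sort : comAlg >-> Sortclass.

HB.instance Definition _ (k : pzRingType) (A : comAlg k) :=
  GRing.Lmodule.copy (comAlg_sort A) (comAlg_mod A).
HB.instance Definition _ (k : pzRingType) (A : comAlg k) :=
  GRing.Zmodule_isComPzRing.Build (comAlg_sort A)
    (@comAlg_mulA k A) (@comAlg_mulC k A) (@comAlg_mul1 k A) (@comAlg_mulDl k A).

Definition comAlg_lmodType (k : pzRingType) (A : comAlg k) : lmodType k :=
  GRing.Lmodule.clone k (comAlg_sort A) _.
Coercion comAlg_lmodType : comAlg >-> GRing.Lmodule.type.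

Definition alghom (k : pzRingType) (U V : comAlg k) (f : U -> V) : Prop :=
  linear f /\ monoid_morphism f.

Section AlgTheory.
Variables (k : pzRingType).

Lemma scale_mull (A : comAlg k) (c : k) (u v : A) : c *: (u * v) = (c *: u) * v.
Proof. exact: comAlg_scalel. Qed.

Lemma scale_mulr (A : comAlg k) (c : k) (u v : A) :
  c *: (u * v) = u * (c *: v).
Proof. by rewrite mulrC scale_mull mulrC. Qed.

Section Lin.
Variables (U V : lmodType k) (f : U -> V) (lf : linear f).
Lemma linD u v : f (u + v) = f u + f v.
Proof. by have := lf 1 u v; rewrite !scale1r. Qed.
Lemma lin0 : f 0 = 0.
Proof. by apply: (@addrI _ (f 0)); rewrite -linD !addr0. Qed.
Lemma linZ c u : f (c *: u) = c *: f u.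
Proof. by have := lf c u 0; rewrite lin0 !addr0. Qed.
Lemma linN u : f (- u) = - f u.
Proof. by rewrite -scaleN1r linZ scaleN1r. Qed.
Lemma linB u v : f (u - v) = f u - f v.
Proof. by rewrite linD linN. Qed.
End Lin.

Section Hom.
Variables (U V : comAlg k) (f : U -> V) (hf : alghom f).
Lemma homL : linear f. Proof. by case: hf. Qed.
Lemma hom1 : f 1 = 1. Proof. by case: hf => _ []. Qed.
Lemma homM u v : f (u * v) = f u * f v. Proof. by case: hf => _ []. Qed.
End Hom.

End AlgTheory.

(* Formal linear combinations: the list [:: (c1, x1); ...] stands for         *)
(* c1 x1 + ... *)
Definition formal (k : fieldType) (X : choiceType) := seq (k * X).

Section Presentation.
Variables (k : fieldType) (X : choiceType).
Local Notation formal := (formal k X).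
Variable R : formal -> formal -> Prop.

Definition fscale (c : k) (s : formal) : formal :=
  [seq (c * p.1, p.2) | p <- s].

Inductive pres_eq : formal -> formal -> Prop :=
| pres_refl s : pres_eq s s
| pres_sym s t : pres_eq s t -> pres_eq t s
| pres_trans s t u : pres_eq s t -> pres_eq t u -> pres_eq s u
| pres_cat s s' t t' :
    pres_eq s s' -> pres_eq t t' -> pres_eq (s ++ t) (s' ++ t')
| pres_catC s t : pres_eq (s ++ t) (t ++ s)
| pres_coefD c d x : pres_eq [:: (c + d, x)] [:: (c, x); (d, x)]
| pres_coef0 x : pres_eq [:: (0, x)] [::]
| pres_rel c s t : R s t -> pres_eq (fscale c s) (fscale c t).

Definition pres_eqb : rel formal := fun s t => `[< pres_eq s t >].

Fact pres_eqb_refl : reflexive pres_eqb.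
Proof. by move=> s; apply/asboolP; exact: pres_refl. Qed.
Fact pres_eqb_sym : symmetric pres_eqb.
Proof. by move=> s t; apply/asboolP/asboolP; exact: pres_sym. Qed.
Fact pres_eqb_trans : transitive pres_eqb.
Proof.
by move=> t s u /asboolP st /asboolP tu; apply/asboolP; exact: pres_trans st tu.
Qed.
Canonical pres_equiv :=
  EquivRel pres_eqb pres_eqb_refl pres_eqb_sym pres_eqb_trans.

(* The quotient of the free k-module on X by the relations s = t, for R s t. *)
Definition pres := {eq_quot pres_eqb}.
HB.instance Definition _ := Choice.on pres.
HB.instance Definition _ := EqQuotient.on pres.

Definition pres_class (s : formal) : pres := \pi_pres s.

Lemma pres_classP s t : pres_class s = pres_class t <-> pres_eq s t.
Proof. by split=> [/eqmodP/asboolP|st] //; apply/eqmodP/asboolP. Qed.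

Lemma pres_classK u : pres_class (repr u) = u.
Proof. exact: reprK. Qed.

Lemma fscale_eq c s t : pres_eq s t -> pres_eq (fscale c s) (fscale c t).
Proof.
elim=> {s t}.
- by move=> s; exact: pres_refl.
- by move=> s t _; exact: pres_sym.
- by move=> s t u _ st _; exact: pres_trans st.
- by move=> s s' t t' _ h _ h'; rewrite /fscale !map_cat; exact: pres_cat.
- by move=> s t; rewrite /fscale !map_cat; exact: pres_catC.
- by move=> a b x; rewrite /fscale /= mulrDr; exact: pres_coefD.
- by move=> x; rewrite /fscale /= mulr0; exact: pres_coef0.
- move=> a s t st; rewrite /fscale -!map_comp.
  by have := pres_rel (c * a) st; congr pres_eq; apply: eq_map => p /=;
    rewrite mulrA.
Qed.

Lemma fscaleDl c d s : pres_eq (fscale (c + d) s) (fscale c s ++ fscale d s).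
Proof.
elim: s => [|[a x] s IH] /=; first exact: pres_refl.
rewrite mulrDl.
have h := pres_cat (pres_coefD (c * a) (d * a) x) IH.
apply: pres_trans h _ => /=.
rewrite -[_ :: _]/([:: (c * a, x)] ++ _) -[in X in pres_eq _ X]cat1s.
apply: pres_cat (pres_refl _) _.
rewrite -[in X in pres_eq _ X](cat1s (d * a, x)) -cat1s !catA.
exact: pres_cat (pres_catC _ _) (pres_refl _).
Qed.

Lemma fscale0 s : pres_eq (fscale 0 s) [::].
Proof.
elim: s => [|[a x] s IH] /=; first exact: pres_refl.
by rewrite mul0r; exact: (pres_cat (pres_coef0 x) IH).
Qed.

Definition pres_add (u v : pres) := pres_class (repr u ++ repr v).
Definition pres_scale (c : k) (u : pres) := pres_class (fscale c (repr u)).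
Definition pres_opp (u : pres) := pres_scale (-1) u.

Lemma pres_addE s t : pres_add (pres_class s) (pres_class t) = pres_class (s ++ t).
Proof. by apply/pres_classP/pres_cat; apply/pres_classP; rewrite pres_classK. Qed.
Lemma pres_scaleE c s : pres_scale c (pres_class s) = pres_class (fscale c s).
Proof. by apply/pres_classP/fscale_eq/pres_classP; rewrite pres_classK. Qed.

Lemma presW (P : pres -> Prop) : (forall s, P (pres_class s)) -> forall u, P u.
Proof. by move=> h u; rewrite -[u]pres_classK. Qed.

Fact pres_addA : associative pres_add.
Proof.
by elim/presW=> s; elim/presW=> t; elim/presW=> u; rewrite !pres_addE catA.
Qed.
Fact pres_addC : commutative pres_add.
Proof.
by elim/presW=> s; elim/presW=> t; rewrite !pres_addE; apply/pres_classP/pres_catC.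
Qed.
Fact pres_add0 : left_id (pres_class [::]) pres_add.
Proof. by elim/presW=> s; rewrite pres_addE. Qed.
Fact pres_addN : left_inverse (pres_class [::]) pres_opp pres_add.
Proof.
elim/presW=> s; rewrite /pres_opp pres_scaleE pres_addE.
apply/pres_classP/(pres_trans _ (fscale0 s)).
have := fscaleDl (-1) 1 s; rewrite addNr => /pres_sym; apply: pres_trans.
apply: pres_cat; first exact: pres_refl.
rewrite -[X in pres_eq X _]map_id.
by rewrite /fscale (eq_map (g := id)) ?map_id; [exact: pres_refl | case=> a x /=; rewrite mul1r].
Qed.
HB.instance Definition _ :=
  GRing.isZmodule.Build pres pres_addA pres_addC pres_add0 pres_addN.

Fact pres_scaleA a b v : pres_scale a (pres_scale b v) = pres_scale (a * b) v.
Proof.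
elim/presW: v => s; rewrite !pres_scaleE /fscale -map_comp.
by congr pres_class; apply: eq_map => p /=; rewrite mulrA.
Qed.
Fact pres_scale1 : left_id 1 pres_scale.
Proof.
elim/presW=> s; rewrite pres_scaleE /fscale (eq_map (g := id)) ?map_id //.
by case=> a x /=; rewrite mul1r.
Qed.
Fact pres_scaleDr : right_distributive pres_scale +%R.
Proof.
move=> c; elim/presW=> s; elim/presW=> t.
by rewrite [_ + _]pres_addE !pres_scaleE [RHS]pres_addE /fscale map_cat.
Qed.
Fact pres_scaleDl v : {morph pres_scale^~ v : a b / a + b}.
Proof.
move=> a b; elim/presW: v => s; rewrite !pres_scaleE [RHS]pres_addE.
exact/pres_classP/fscaleDl.
Qed.
HB.instance Definition _ := GRing.Zmodule_isLmodule.Build k pres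
  pres_scaleA pres_scale1 pres_scaleDr pres_scaleDl.

Definition pgen (x : X) : pres := pres_class [:: (1, x)].

Lemma pres_consE c x s : pres_class ((c, x) :: s) = c *: pgen x + pres_class s.
Proof.
by rewrite [c *: _]pres_scaleE [RHS]pres_addE /= mulr1.
Qed.

Lemma pres_sumE s : pres_class s = \sum_(p <- s) p.1 *: pgen p.2.
Proof.
elim: s => [|[c x] s IH]; first by rewrite big_nil.
by rewrite pres_consE IH big_cons.
Qed.

Lemma pres_relE s t : R s t ->
  \sum_(p <- s) p.1 *: pgen p.2 = \sum_(p <- t) p.1 *: pgen p.2.
Proof.
move=> st; rewrite -!pres_sumE; apply/pres_classP.
have := pres_rel 1 st; congr pres_eq; rewrite /fscale -[RHS]map_id;
  by apply: eq_map; case=> a x /=; rewrite mul1r.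
Qed.

Lemma pres_elim (P : pres -> Prop) :
  P 0 -> (forall c x u, P u -> P (c *: pgen x + u)) -> forall u, P u.
Proof.
move=> P0 PS; elim/presW; elim=> [|[c x] s IH] //.
by rewrite pres_consE; exact: PS.
Qed.

Section Lift.
Variables (W : lmodType k) (f : X -> W).

Definition peval (s : formal) : W := \sum_(p <- s) p.1 *: f p.2.
Definition plift (u : pres) : W := peval (repr u).
Definition respects := forall s t, R s t -> peval s = peval t.
Hypothesis fR : respects.

Lemma peval_scale c s : peval (fscale c s) = c *: peval s.
Proof.
rewrite /peval big_map scaler_sumr; apply: eq_bigr => p _ /=.
by rewrite scalerA.
Qed.

Lemma peval_eq s t : pres_eq s t -> peval s = peval t.
Proof.
elim=> {s t} //.
- by move=> s t u _ -> _ ->.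
- by move=> s s' t t' _ h _ h'; rewrite /peval !big_cat /= -!/(peval _) h h'.
- by move=> s t; rewrite /peval !big_cat /= addrC.
- by move=> c d x; rewrite /peval !big_cons !big_nil /= !addr0 scalerDl.
- by move=> x; rewrite /peval big_cons big_nil /= addr0 scale0r.
- by move=> c s t st; rewrite !peval_scale (fR st).
Qed.

Lemma plift_class s : plift (pres_class s) = peval s.
Proof. by apply/peval_eq/pres_classP; rewrite pres_classK. Qed.

Lemma plift_gen x : plift (pgen x) = f x.
Proof. by rewrite plift_class /peval big_cons big_nil addr0 scale1r. Qed.

Lemma plift_linear : linear plift.
Proof.
move=> c; elim/presW=> s; elim/presW=> t.
rewrite [c *: _]pres_scaleE [_ + _]pres_addE !plift_class /peval big_cat /=.
by rewrite -!/(peval _) peval_scale.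
Qed.

End Lift.

Lemma pres_lin_ext (W : lmodType k) (f g : pres -> W) :
  linear f -> linear g -> (forall x, f (pgen x) = g (pgen x)) -> f =1 g.
Proof.
move=> lf lg h; elim/pres_elim => [|c x u IH]; first by rewrite !lin0.
by rewrite lf lg h IH.
Qed.

(* A product of generators, associative, commutative, unital and compatible   *)
(* with the relations, extends to a commutative algebra structure.            *)
Section Mul.
Variables (op : X -> X -> X) (e : X).

Definition pres_mul (u v : pres) : pres :=
  plift (fun x => plift (fun y => pgen (op x y)) v) u.

Hypothesis op_rel : forall x s t, R s t ->
  pres_eq [seq (p.1, op x p.2) | p <- s] [seq (p.1, op x p.2) | p <- t].
Hypothesis opA : forall x y z, pgen (op x (op y z)) = pgen (op (op x y) z).
Hypothesis opC : forall x y, pgen (op x y) = pgen (op y x).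
Hypothesis op1 : forall x, pgen (op e x) = pgen x.

Let op_respr x : respects (fun y => pgen (op x y)).
Proof.
move=> s t st; have /pres_classP := op_rel x st.
by rewrite !pres_sumE !big_map.
Qed.

Let op_respl v : respects (fun x => plift (fun y => pgen (op x y)) v).
Proof.
move=> s t st; move: v.
have sumlin (r : formal) : linear
    (fun v => peval (fun x => plift (fun y => pgen (op x y)) v) r).
  move=> c u v; rewrite /peval scaler_sumr -big_split /=.
  apply: eq_bigr => p _; rewrite (plift_linear (op_respr _)).
  by rewrite scalerDr !scalerA [c * _]mulrC.
apply: pres_lin_ext (sumlin s) (sumlin t) _ => y.
have E (r : formal) : peval (fun x => plift (fun y => pgen (op x y)) (pgen y)) r
    = peval (fun x => pgen (op y x)) r.
  by apply: eq_bigr => p _; rewrite (plift_gen (op_respr _)) opC.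
by rewrite !E (op_respr y st).
Qed.

Lemma pres_mulE x y : pres_mul (pgen x) (pgen y) = pgen (op x y).
Proof. by rewrite /pres_mul (plift_gen (op_respl _)) (plift_gen (op_respr _)). Qed.

Lemma pres_mul_linl v : linear (pres_mul^~ v).
Proof. exact: plift_linear (op_respl _). Qed.

Lemma pres_mulC : commutative pres_mul.
Proof.
have linr u : linear (pres_mul u).
  move: u; apply: pres_elim => [c v w|a x u IH c v w].
    by rewrite !(lin0 (pres_mul_linl _)) scaler0 addr0.
  rewrite !pres_mul_linl IH /pres_mul !(plift_gen (op_respl _)).
  rewrite (plift_linear (op_respr _)) !scalerDr !scalerA [a * c]mulrC.
  by rewrite addrACA.
move=> u v; move: u.
apply: pres_lin_ext (pres_mul_linl v) (linr v) _ => x; move: v.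
apply: pres_lin_ext (linr _) (pres_mul_linl _) _ => y.
by rewrite !pres_mulE opC.
Qed.

Lemma pres_mul_linr u : linear (pres_mul u).
Proof. by move=> c v w; rewrite !(pres_mulC u) pres_mul_linl. Qed.

Lemma pres_mulA : associative pres_mul.
Proof.
move=> u v w; move: u.
have comp (U V W : lmodType k) (f : V -> W) (g : U -> V) :
    linear f -> linear g -> linear (fun x => f (g x)).
  by move=> lf lg c x y; rewrite lg lf.
apply: pres_lin_ext; first exact: pres_mul_linl.
  exact: (comp _ _ _ (pres_mul^~ w) (pres_mul^~ v)
    (pres_mul_linl _) (pres_mul_linl _)).
move=> x; move: v; apply: pres_lin_ext.
- exact: (comp _ _ _ (pres_mul (pgen x)) (pres_mul^~ w)
    (pres_mul_linr _) (pres_mul_linl _)).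
- exact: (comp _ _ _ (pres_mul^~ w) (pres_mul (pgen x))
    (pres_mul_linl _) (pres_mul_linr _)).
move=> y; move: w; apply: pres_lin_ext.
- exact: (comp _ _ _ (pres_mul _) (pres_mul _)
    (pres_mul_linr _) (pres_mul_linr _)).
- exact: pres_mul_linr.
by move=> z; rewrite !pres_mulE opA.
Qed.

Lemma pres_mul1 : left_id (pgen e) pres_mul.
Proof.
apply: pres_lin_ext => [||x]; first exact: pres_mul_linr.
  by move=> c u v.
by rewrite pres_mulE op1.
Qed.

Lemma pres_mulDl : left_distributive pres_mul +%R.
Proof. by move=> u v w; rewrite (linD (pres_mul_linl w)). Qed.

Lemma pres_scale_mull c u v : c *: pres_mul u v = pres_mul (c *: u) v.
Proof. by rewrite (linZ (pres_mul_linl v)). Qed.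

End Mul.
End Presentation.

Arguments pres_elim {k X R} P.

Section Submodules.
Variables (k : pzRingType) (V : lmodType k).

Definition submodule (W : set V) : Prop :=
  W 0 /\ forall c u v, W u -> W v -> W (c *: u + v).

Inductive lin_span (S : set V) : V -> Prop :=
| lin_span0 : lin_span S 0
| lin_spanP c u v : S u -> lin_span S v -> lin_span S (c *: u + v).

Lemma lin_span_submodule (S : set V) : submodule (lin_span S).
Proof.
split=> [|c u v]; first exact: lin_span0.
elim=> [|d x w Sx _ IH] Sv; first by rewrite scaler0 add0r.
by rewrite scalerDr scalerA -addrA; apply: lin_spanP => //; exact: IH.
Qed.

Lemma sub_lin_span (S : set V) u : S u -> lin_span S u.
Proof.
by move=> Su; rewrite -[u]addr0 -[u]scale1r; apply: lin_spanP => //; exact: lin_span0.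
Qed.

Variables (W : set V) (hW : submodule W).

Definition submod_pred of submodule W : {pred V} := fun x => `[< W x >].

Fact submod_pred_closed : submod_closed (submod_pred hW).
Proof.
case: (hW) => W0 WS; split=> [|c u v /asboolP Wu /asboolP Wv]; apply/asboolP => //.
exact: WS.
Qed.
HB.instance Definition _ :=
  GRing.isSubmodClosed.Build k V (submod_pred hW) submod_pred_closed.

Record submod_type := Submod { submod_val : V; _ : submod_val \in submod_pred hW }.
HB.instance Definition _ := [isSub for submod_val].
HB.instance Definition _ := [Choice of submod_type by <:].
HB.instance Definition _ := [SubChoice_isSubLmodule of submod_type by <:].

Definition submod_mk (u : V) (Wu : W u) : submod_type := Submod (asboolT Wu).

Lemma submod_valP (u : submod_type) : W (submod_val u).
Proof. by case: u => u Wu; exact: asboolW Wu. Qed.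

End Submodules.

Section DirectSum.
Variables (k : fieldType) (I : Type) (V : lmodType k).

Definition fin_supp : set (I -> V) := [set f | finite_set [set i | f i != 0]].

Fact fin_supp_submodule : submodule fin_supp.
Proof.
split=> [|c f g ff fg].
  rewrite /fin_supp /= (_ : [set i | _] = classical_sets.set0) ?finite_set0 //.
  by rewrite -subset0 => i /=; rewrite eqxx.
have fU : finite_set ([set i | f i != 0] `|` [set i | g i != 0])%classic.
  by rewrite finite_setU.
apply: sub_finite_set fU => i /= fgi; apply: contrapT => /not_orP[].
move=> /negP; rewrite negbK => /eqP fi /negP; rewrite negbK => /eqP gi.
by move: fgi; rewrite -[(_ + _) i]/(c *: f i + g i) fi gi scaler0 addr0 eqxx.
Qed.

Definition dsum := submod_type fin_supp_submodule.
HB.instance Definition _ := GRing.Lmodule.on dsum.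

Definition delta_fun (i : I) (v : V) : I -> V :=
  fun j => if pselect (j = i) then v else 0.

Fact delta_fin_supp i v : fin_supp (delta_fun i v).
Proof.
apply: sub_finite_set (finite_set1 i) => j /=; rewrite /delta_fun.
by case: pselect => //= _; rewrite eqxx.
Qed.

Definition dsum_in (i : I) (v : V) : dsum := submod_mk _ (delta_fin_supp i v).

Lemma dsum_in_linear i : linear (dsum_in i).
Proof.
move=> c u v; apply: val_inj => /=; apply: funext => j.
rewrite -[RHS]/(c *: delta_fun i u j + delta_fun i v j) /delta_fun.
by case: pselect => //= _; rewrite scaler0 addr0.
Qed.

End DirectSum.

Section DirectSumMap.
Variables (k : fieldType) (I : Type) (V W : lmodType k) (f : V -> W).
Variable (lf : linear f).

Fact dsum_map_fin_supp (u : dsum I V) : fin_supp (f \o submod_val u).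
Proof.
apply: sub_finite_set (submod_valP u) => i /=; apply: contra_neq => ->.
exact: lin0 lf.
Qed.

Definition dsum_map (u : dsum I V) : dsum I W := submod_mk _ (dsum_map_fin_supp u).

Lemma dsum_map_linear : linear dsum_map.
Proof. by move=> c u v; apply: val_inj; apply: funext => i /=; exact: lf. Qed.

Lemma dsum_map_in i v : dsum_map (dsum_in i v) = dsum_in i (f v).
Proof.
apply: val_inj; apply: funext => j; rewrite /= /delta_fun.
by case: pselect => //= _; exact: lin0 lf.
Qed.
End DirectSumMap.

Section Tensor.
Variable (k : fieldType).

Inductive tens_rel (U V : lmodType k) :
    formal k (U * V)%type -> formal k (U * V)%type -> Prop :=
| tens_Dl u u' v : tens_rel [:: (1, (u + u', v))] [:: (1, (u, v)); (1, (u', v))]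
| tens_Dr u v v' : tens_rel [:: (1, (u, v + v'))] [:: (1, (u, v)); (1, (u, v'))]
| tens_Zl c u v : tens_rel [:: (1, (c *: u, v))] [:: (c, (u, v))]
| tens_Zr c u v : tens_rel [:: (1, (u, c *: v))] [:: (c, (u, v))].

Definition tensor (U V : lmodType k) := pres (@tens_rel U V).

Section Module.
Variables U V : lmodType k.
HB.instance Definition _ := GRing.Lmodule.on (tensor U V).

Definition tens (u : U) (v : V) : tensor U V := pgen (@tens_rel U V) (u, v).

Lemma tens_linl v : linear (tens^~ v).
Proof.
move=> c u u'.
have := pres_relE (tens_Dl (c *: u) u' v); rewrite !big_cons !big_nil /=.
rewrite !addr0 !scale1r => hD.
have := pres_relE (tens_Zl c u v); rewrite !big_cons !big_nil /=.
by rewrite !addr0 !scale1r => hZ; rewrite /tens hD hZ.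
Qed.

Lemma tens_linr u : linear (tens u).
Proof.
move=> c v v'.
have := pres_relE (tens_Dr u (c *: v) v'); rewrite !big_cons !big_nil /=.
rewrite !addr0 !scale1r => hD.
have := pres_relE (tens_Zr c u v); rewrite !big_cons !big_nil /=.
by rewrite !addr0 !scale1r => hZ; rewrite /tens hD hZ.
Qed.

Definition tens_lift (W : lmodType k) (f : U -> V -> W) : tensor U V -> W :=
  plift (fun p => f p.1 p.2).

Section TensLift.
Variables (W : lmodType k) (f : U -> V -> W).
Hypotheses (fl : forall v, linear (f^~ v)) (fr : forall u, linear (f u)).

Let tens_resp : respects (@tens_rel U V) (fun p => f p.1 p.2).
Proof.
move=> s t [u u' v|u v v'|c u v|c u v]; rewrite /peval !big_cons !big_nil /=.
- by rewrite !addr0 !scale1r (linD (fl v)).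
- by rewrite !addr0 !scale1r (linD (fr u)).
- by rewrite !addr0 !scale1r (linZ (fl v)).
- by rewrite !addr0 !scale1r (linZ (fr u)).
Qed.

Lemma tens_lift_linear : linear (tens_lift f).
Proof. exact: plift_linear tens_resp. Qed.
Lemma tens_liftE u v : tens_lift f (tens u v) = f u v.
Proof. exact: (plift_gen tens_resp). Qed.
End TensLift.

Lemma tens_ext (W : lmodType k) (f g : tensor U V -> W) :
  linear f -> linear g -> (forall u v, f (tens u v) = g (tens u v)) -> f =1 g.
Proof. by move=> lf lg h; apply: pres_lin_ext => // -[u v]; exact: h. Qed.

Lemma tens_elim (P : tensor U V -> Prop) : P 0 ->
  (forall c u v x, P x -> P (c *: tens u v + x)) -> forall x, P x.
Proof. by move=> P0 PS; apply: pres_elim => // c [u v] x; exact: PS. Qed.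

End Module.

Section Algebra.
Variables U V : comAlg k.

Definition tens_op (p q : U * V) : U * V := (p.1 * q.1, p.2 * q.2).

Fact tens_op_rel x s t : @tens_rel U V s t ->
  pres_eq (@tens_rel U V)
    [seq (p.1, tens_op x p.2) | p <- s] [seq (p.1, tens_op x p.2) | p <- t].
Proof.
move=> st; apply/pres_classP; rewrite !pres_sumE !big_map.
case: x => a b; case: st => [u u' v|u v v'|c u v|c u v];
  rewrite !big_cons !big_nil /= /tens_op /= !addr0 !scale1r -!/(tens _ _).
- by rewrite mulrDr (linD (tens_linl _)).
- by rewrite mulrDr (linD (tens_linr _)).
- by rewrite -scale_mulr (linZ (tens_linl _)).
- by rewrite -scale_mulr (linZ (tens_linr _)).
Qed.
Fact tens_opA x y z : pgen (@tens_rel U V) (tens_op x (tens_op y z)) =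
  pgen (@tens_rel U V) (tens_op (tens_op x y) z).
Proof. by rewrite /tens_op /= !mulrA. Qed.
Fact tens_opC x y :
  pgen (@tens_rel U V) (tens_op x y) = pgen (@tens_rel U V) (tens_op y x).
Proof. by rewrite /tens_op ![_ * y.1]mulrC ![_ * y.2]mulrC. Qed.
Fact tens_op1 x :
  pgen (@tens_rel U V) (tens_op (1, 1) x) = pgen (@tens_rel U V) x.
Proof. by case: x => a b; rewrite /tens_op !mul1r. Qed.

Definition tensor_alg : comAlg k := @ComAlg k (tensor U V) (@tens U V 1 1) _
  (pres_mulA tens_op_rel tens_opA tens_opC)
  (pres_mulC tens_op_rel tens_opC)
  (pres_mul1 tens_op_rel tens_opC tens_op1)
  (pres_mulDl tens_op_rel tens_opC)
  (pres_scale_mull tens_op_rel tens_opC).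

Definition atens (u : U) (v : V) : tensor_alg := @tens U V u v.

Lemma atens_linl v : linear (atens^~ v). Proof. exact: tens_linl. Qed.
Lemma atens_linr u : linear (atens u). Proof. exact: tens_linr. Qed.
Lemma atens1 : atens 1 1 = 1. Proof. by []. Qed.
Lemma atensM (u u' : U) (v v' : V) :
  atens u v * atens u' v' = atens (u * u') (v * v').
Proof. exact: (pres_mulE tens_op_rel tens_opC). Qed.

Lemma atens_elim (P : tensor_alg -> Prop) : P 0 ->
  (forall c u v x, P x -> P (c *: atens u v + x)) -> forall x, P x.
Proof. exact: tens_elim. Qed.

Lemma atens_lift_alghom (W : comAlg k) (f : U -> V -> W) :
  (forall v, linear (f^~ v)) -> (forall u, linear (f u)) -> f 1 1 = 1 ->
  (forall u u' v v', f (u * u') (v * v') = f u v * f u' v') ->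
  alghom (tens_lift f : tensor_alg -> W).
Proof.
move=> fl fr f1 fM.
have lin : linear (tens_lift f : tensor_alg -> W) := tens_lift_linear fl fr.
have E u v : tens_lift f (atens u v) = f u v := tens_liftE fl fr u v.
split=> //; split=> [|x y]; first by rewrite -atens1 E.
elim/atens_elim: x => [|c u v x IH]; first by rewrite mul0r (lin0 lin) mul0r.
rewrite mulrDl !(linD lin) IH mulrDl; congr (_ + _).
rewrite -scale_mull !(linZ lin) -scale_mull; congr (_ *: _).
elim/atens_elim: y {IH} => [|d u' v' y IHy]; first by rewrite mulr0 (lin0 lin) mulr0.
rewrite mulrDr !(linD lin) IHy mulrDr; congr (_ + _).
by rewrite -scale_mulr !(linZ lin) -scale_mulr atensM !E fM.
Qed.

End Algebra.
End Tensor.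

Section Symmetric.
Variable (k : fieldType).

(* The word [:: v1; ...; vn] stands for the product v1 ... vn in S^n(V).      *)
Inductive sym_rel (V : lmodType k) :
    formal k (seq V) -> formal k (seq V) -> Prop :=
| sym_perm s t : perm_eq s t -> sym_rel [:: (1, s)] [:: (1, t)]
| sym_D u v s : sym_rel [:: (1, u + v :: s)] [:: (1, u :: s); (1, v :: s)]
| sym_Z c v s : sym_rel [:: (1, c *: v :: s)] [:: (c, v :: s)].

Definition sym (V : lmodType k) := pres (@sym_rel V).

Section Algebra.
Variable V : lmodType k.
HB.instance Definition _ := GRing.Lmodule.on (sym V).

Definition word (s : seq V) : sym V := pgen (@sym_rel V) s.

Lemma word_perm s t : perm_eq s t -> word s = word t.
Proof.
move=> st; have := pres_relE (sym_perm st).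
by rewrite !big_cons !big_nil /= !addr0 !scale1r.
Qed.
Lemma word_lin s : linear (fun v => word (v :: s)).
Proof.
move=> c u v.
have := pres_relE (sym_D (c *: u) v s); rewrite !big_cons !big_nil /=.
rewrite !addr0 !scale1r => hD.
have := pres_relE (sym_Z c u s); rewrite !big_cons !big_nil /=.
by rewrite !addr0 !scale1r => hZ; rewrite /word hD hZ.
Qed.

Fact sym_op_rel x s t : @sym_rel V s t ->
  pres_eq (@sym_rel V)
    [seq (p.1, x ++ p.2) | p <- s] [seq (p.1, x ++ p.2) | p <- t].
Proof.
move=> st; apply/pres_classP; rewrite !pres_sumE !big_map.
have mid v r : word (x ++ v :: r) = word (v :: x ++ r).
  by apply: word_perm; rewrite -cat1s perm_catCA.
case: st => [{}s {}t st|u v r|c v r];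
  rewrite !big_cons !big_nil /= !addr0 !scale1r -!/(word _).
- by apply: word_perm; rewrite perm_cat2l.
- by rewrite !mid (linD (word_lin _)).
- by rewrite !mid (linZ (word_lin _)).
Qed.
Fact sym_opA x y z : pgen (@sym_rel V) (x ++ (y ++ z)) =
  pgen (@sym_rel V) ((x ++ y) ++ z).
Proof. by rewrite catA. Qed.
Fact sym_opC x y : pgen (@sym_rel V) (x ++ y) = pgen (@sym_rel V) (y ++ x).
Proof. by apply: word_perm; rewrite perm_catC. Qed.
Fact sym_op1 x : pgen (@sym_rel V) ([::] ++ x) = pgen (@sym_rel V) x.
Proof. by []. Qed.

Definition sym_alg : comAlg k := @ComAlg k (sym V) (word [::]) _
  (pres_mulA sym_op_rel sym_opA sym_opC)
  (pres_mulC sym_op_rel sym_opC)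
  (pres_mul1 sym_op_rel sym_opC sym_op1)
  (pres_mulDl sym_op_rel sym_opC)
  (pres_scale_mull sym_op_rel sym_opC).

Definition monom (s : seq V) : sym_alg := word s.

Lemma monom_nil : monom [::] = 1. Proof. by []. Qed.
Lemma monom_cat s t : monom (s ++ t) = monom s * monom t.
Proof. exact/esym/(pres_mulE sym_op_rel sym_opC). Qed.
Lemma monom_lin s : linear (fun v => monom (v :: s)).
Proof. exact: word_lin. Qed.
Lemma monom_perm s t : perm_eq s t -> monom s = monom t.
Proof. exact: word_perm. Qed.

Lemma monom_elim (P : sym_alg -> Prop) : P 0 ->
  (forall c s x, P x -> P (c *: monom s + x)) -> forall x, P x.
Proof. exact: pres_elim. Qed.

Section SymLift.
Variables (W : lmodType k) (f : seq V -> W).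
Hypotheses (fp : forall s t, perm_eq s t -> f s = f t)
  (fl : forall s, linear (fun v => f (v :: s))).

Let sym_resp : respects (@sym_rel V) f.
Proof.
move=> s t [{}s {}t st|u v r|c v r]; rewrite /peval !big_cons !big_nil /=.
- by rewrite !addr0 !scale1r (fp st).
- by rewrite !addr0 !scale1r (linD (fl r)).
- by rewrite !addr0 !scale1r (linZ (fl r)).
Qed.

Lemma sym_lift_linear : linear (plift (R := @sym_rel V) f).
Proof. exact: plift_linear sym_resp. Qed.
Lemma sym_liftE s : plift f (word s) = f s.
Proof. exact: (plift_gen sym_resp). Qed.
End SymLift.


(* S^+(V), the sum of the S^n(V) for n >= 1. *)
Definition sym_plus : set sym_alg :=
  lin_span [set x | exists v s, x = monom (v :: s)].

(* The projection S(V) -> S^0(V) = k. *)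
Definition sym_eps (x : sym_alg) : k :=
  plift (fun s : seq V => (nilp s)%:R : k^o) x.

Let nil_p (s t : seq V) : perm_eq s t -> (nilp s)%:R = (nilp t)%:R :> k^o.
Proof. by move/perm_size => st; rewrite /nilp st. Qed.
Let nil_l (s : seq V) : linear (fun v : V => (nilp (v :: s))%:R : k^o).
Proof. by move=> c u v; rewrite /= scaler0 addr0. Qed.

Lemma sym_eps_lin c x y : sym_eps (c *: x + y) = c * sym_eps x + sym_eps y.
Proof. exact: (sym_lift_linear nil_p nil_l). Qed.
Lemma sym_eps_monom s : sym_eps (monom s) = (nilp s)%:R.
Proof. exact: (sym_liftE nil_p nil_l). Qed.
Lemma sym_eps0 : sym_eps 0 = 0.
Proof. exact: (lin0 (sym_lift_linear nil_p nil_l)). Qed.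
Lemma sym_eps1 : sym_eps 1 = 1.
Proof. by rewrite -monom_nil sym_eps_monom. Qed.
Lemma sym_epsM x y : sym_eps (x * y) = sym_eps x * sym_eps y.
Proof.
elim/monom_elim: x => [|c s x IH]; first by rewrite mul0r sym_eps0 mul0r.
rewrite mulrDl -scale_mull !sym_eps_lin IH mulrDl -mulrA; congr (c * _ + _).
elim/monom_elim: y {IH} => [|d t y IH]; first by rewrite mulr0 sym_eps0 mulr0.
rewrite mulrDr -scale_mulr !sym_eps_lin IH mulrDr mulrCA; congr (d * _ + _).
rewrite -monom_cat !sym_eps_monom -natrM mulnb /nilp size_cat.
by rewrite addn_eq0.
Qed.

Lemma sym_eps_plus x : sym_plus x -> sym_eps x = 0.
Proof.
elim=> [|c u v [w [s ->]] _ IH]; first exact: sym_eps0.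
by rewrite sym_eps_lin IH sym_eps_monom mulr0 addr0.
Qed.

Lemma sym_decomp x : sym_plus (x - sym_eps x *: (1 : sym_alg)).
Proof.
elim/monom_elim: x => [|c s x IH].
  by rewrite sym_eps0 scale0r subr0; exact: lin_span0.
rewrite sym_eps_lin sym_eps_monom scalerDl opprD addrACA -scalerA -scalerBr.
case: s => [|v s] /=; last by rewrite scale0r subr0; apply: lin_spanP => //; exists v, s.
by rewrite scale1r monom_nil subrr scaler0 add0r.
Qed.

End Algebra.

Section Functor.
Variables (V W : lmodType k) (f : V -> W) (lf : linear f).

Definition sym_map : sym_alg V -> sym_alg W :=
  plift (fun s => monom (map f s)).

Let map_p s t : perm_eq s t -> monom (map f s) = monom (map f t).
Proof. by move=> st; apply/monom_perm/perm_map. Qed.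
Let map_l s : linear (fun v => monom (map f (v :: s))).
Proof. by move=> c u v; rewrite /= lf monom_lin. Qed.

Lemma sym_map_linear : linear sym_map.
Proof. exact: (sym_lift_linear map_p map_l). Qed.
Lemma sym_map_monom s : sym_map (monom s) = monom (map f s).
Proof. exact: (sym_liftE map_p map_l). Qed.

Lemma sym_map_alghom : alghom sym_map.
Proof.
have lin := sym_map_linear.
split=> //; split=> [|x y]; first by rewrite -monom_nil sym_map_monom.
elim/monom_elim: x => [|c s x IH]; first by rewrite mul0r (lin0 lin) mul0r.
rewrite mulrDl -scale_mull !lin IH mulrDl -scale_mull; congr (c *: _ + _).
elim/monom_elim: y {IH} => [|d t y IH]; first by rewrite mulr0 (lin0 lin) mulr0.
rewrite mulrDr -scale_mulr !lin IH mulrDr -scale_mulr; congr (d *: _ + _).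
by rewrite -monom_cat !sym_map_monom map_cat monom_cat.
Qed.

Lemma sym_eps_map x : sym_eps (sym_map x) = sym_eps x.
Proof.
elim/monom_elim: x => [|c s x IH].
  by rewrite (lin0 sym_map_linear) !sym_eps0.
by rewrite sym_map_linear !sym_eps_lin IH sym_map_monom !sym_eps_monom /nilp size_map.
Qed.

End Functor.
End Symmetric.

Section KAugmented.
Variables (k : fieldType) (B : comAlg k).

(* B = k (+) B^+ as a direct sum of k-subalgebras, B^+ not required unital. *)
Definition augmented (Bp : set B) : Prop :=
  [/\ submodule Bp,
      forall u v, Bp u -> Bp v -> Bp (u * v) &
      forall b, exists! cu : k * B, Bp cu.2 /\ b = cu.1 *: (1 : B) + cu.2].

Variables (Bp : set B) (hB : augmented Bp).

Lemma kaug_exists b : exists c : k, Bp (b - c *: (1 : B)).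
Proof.
case: hB => _ _ /(_ b) [[c u] [[/= Bu ->] _]]; exists c.
by rewrite addrAC subrr add0r.
Qed.

(* The projection B -> k along B^+. *)
Definition kaug_eps (b : B) : k := projT1 (cid (kaug_exists b)).

Lemma kaug_epsP b : Bp (b - kaug_eps b *: (1 : B)).
Proof. exact: projT2 (cid (kaug_exists b)). Qed.

Lemma kaug_eps_uniq c u : Bp u -> kaug_eps (c *: (1 : B) + u) = c.
Proof.
move=> Bu; case: hB => _ _ /(_ (c *: (1 : B) + u)) [x [_ Ux]].
have h1 := Ux (c, u) (conj Bu erefl).
have h2 := Ux (kaug_eps (c *: (1 : B) + u), _) (conj (kaug_epsP _) _).
by move: h2; rewrite h1 => /(_ _ (esym (subrKC _ _))) [].
Qed.

Lemma kaug_eps_lin c a b : kaug_eps (c *: a + b) = c * kaug_eps a + kaug_eps b.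
Proof.
case: (hB) => -[B0 BS] _ _.
rewrite -[RHS](kaug_eps_uniq _ (BS c _ _ (kaug_epsP a) (kaug_epsP b))).
congr kaug_eps; rewrite scalerDl -scalerA addrACA -scalerDr.
by rewrite !subrKC.
Qed.

Lemma kaug_eps1 : kaug_eps 1 = 1.
Proof.
case: (hB) => -[B0 _] _ _; have := kaug_eps_uniq 1 B0.
by rewrite scale1r addr0.
Qed.

Lemma kaug_eps_plus u : Bp u -> kaug_eps u = 0.
Proof. by move=> Bu; have := kaug_eps_uniq 0 Bu; rewrite scale0r add0r. Qed.

Lemma kaug_epsM a b : kaug_eps (a * b) = kaug_eps a * kaug_eps b.
Proof.
case: (hB) => -[B0 BS] BM _.
set x := kaug_eps a; set y := kaug_eps b.
have [a' [Ba aE]] : exists a', Bp a' /\ a = x *: (1 : B) + a'.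
  by exists (a - x *: (1 : B)); rewrite subrKC; split=> //; exact: kaug_epsP.
have [b' [Bb bE]] : exists b', Bp b' /\ b = y *: (1 : B) + b'.
  by exists (b - y *: (1 : B)); rewrite subrKC; split=> //; exact: kaug_epsP.
have Bc : Bp (x *: b' + (y *: a' + (1 *: (a' * b') + 0))).
  by apply: (BS) => //; apply: (BS) => //; apply: (BS) => //; exact: BM.
rewrite -[RHS](kaug_eps_uniq _ Bc) {1}aE {1}bE; congr kaug_eps.
rewrite mulrDl !mulrDr -!scale_mull -!scale_mulr !mul1r !mulr1.
by rewrite scale1r addr0 scalerA !addrA.
Qed.

End KAugmented.

(* An algebra X with an algebra map j : A -> X and a decomposition            *)
(* X = j(A) (+) X^+, recorded through the projection onto A along X^+, which  *)
(* is an algebra homomorphism.                                                *)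
Record augalg (k : fieldType) (A : comAlg k) := AugAlg {
  aug_car :> comAlg k;
  aug_j : A -> aug_car;
  aug_eps : aug_car -> A;
  aug_plus : set aug_car;
  aug_j_hom : alghom aug_j;
  aug_eps_hom : alghom aug_eps;
  aug_jK : cancel aug_j aug_eps;
  aug_plusP : forall u, aug_plus u <-> aug_eps u = 0
}.
Arguments aug_j {k A} X _ : rename.
Arguments aug_eps {k A} X _ : rename.
Arguments aug_plus {k A} X _ : rename.

Section AugTheory.
Variables (k : fieldType) (A : comAlg k).

Section One.
Variable X : augalg A.

Lemma aug_decomp (u : X) : aug_plus X (u - aug_j X (aug_eps X u)).
Proof.
by apply/aug_plusP; rewrite (linB (homL (aug_eps_hom X))) aug_jK subrr.
Qed.

Lemma aug_direct (u : X) :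
  exists! av : A * X, aug_plus X av.2 /\ u = aug_j X av.1 + av.2.
Proof.
have le := homL (aug_eps_hom X).
exists (aug_eps X u, u - aug_j X (aug_eps X u)); split=> [|[a v]] /=.
  by split; [exact: aug_decomp | rewrite subrKC].
case=> /aug_plusP ev ->; rewrite (linD le) aug_jK ev addr0.
by rewrite addrAC subrr add0r.
Qed.

Lemma aug_plus_submodule : submodule (aug_plus X).
Proof.
have le := homL (aug_eps_hom X).
split=> [|c u v /aug_plusP eu /aug_plusP ev]; apply/aug_plusP.
  by rewrite (lin0 le).
by rewrite le eu ev scaler0 addr0.
Qed.

Definition aug_plusT := submod_type aug_plus_submodule.
HB.instance Definition _ := GRing.Lmodule.on aug_plusT.

Definition aug_proj (u : X) : aug_plusT :=
  submod_mk aug_plus_submodule (aug_decomp u).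

Lemma aug_proj_linear : linear aug_proj.
Proof.
have le := homL (aug_eps_hom X); have lj := homL (aug_j_hom X).
move=> c u v; apply: val_inj => /=.
by rewrite le lj scalerBr addrACA -opprD.
Qed.

Lemma aug_proj_id (u : aug_plusT) : aug_proj (submod_val u) = u.
Proof.
apply: val_inj => /=; have /aug_plusP -> := submod_valP u.
by rewrite (lin0 (homL (aug_j_hom X))) subr0.
Qed.

Lemma aug_proj_j a : aug_proj (aug_j X a) = 0.
Proof. by apply: val_inj; rewrite /= aug_jK subrr. Qed.

End One.

Record aughom (X Y : augalg A) := AugHom {
  aughom_fun :> X -> Y;
  aughom_hom : alghom aughom_fun;
  aughom_eps : forall u, aug_eps Y (aughom_fun u) = aug_eps X u;
  aughom_j : forall a, aughom_fun (aug_j X a) = aug_j Y a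
}.

Section PlusMap.
Variables (X Y : augalg A) (f : aughom X Y).

Fact plus_map_subproof (u : aug_plusT X) : aug_plus Y (f (submod_val u)).
Proof. apply/aug_plusP; rewrite aughom_eps. have := submod_valP u. by move/aug_plusP. Qed.

Definition plus_map (u : aug_plusT X) : aug_plusT Y :=
  submod_mk (aug_plus_submodule Y) (plus_map_subproof u).

Lemma plus_map_linear : linear plus_map.
Proof. by move=> c u v; apply: val_inj; exact: (homL (aughom_hom f)). Qed.

Lemma plus_map_proj u : plus_map (aug_proj u) = aug_proj (f u).
Proof.
apply: val_inj; rewrite /= (linB (homL (aughom_hom f))).
by rewrite aughom_j aughom_eps.
Qed.

End PlusMap.
End AugTheory.

(* C = A (x) B, with A embedded as A (x) 1. As k is a field, A (x) B^+ is the  *)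
(* submodule of A (x) B spanned by the a (x) b, b in B^+.                     *)
Section Base.
Variables (k : fieldType) (A B : comAlg k) (Bp : set B) (hB : augmented Bp).
Local Notation AB := (tensor_alg A B).

Definition base_j (a : A) : AB := atens a 1.
Definition base_eps (x : AB) : A :=
  tens_lift (fun (a : A) (b : B) => kaug_eps hB b *: a) x.
Definition base_plus : set AB :=
  lin_span [set x | exists (a : A) (b : B), Bp b /\ x = atens a b].

Fact base_j_hom : alghom base_j.
Proof.
split; first exact: atens_linl.
by split=> // a a'; rewrite /base_j atensM mulr1.
Qed.

Let fl (b : B) : linear (fun a : A => kaug_eps hB b *: a).
Proof. by move=> c u v; rewrite scalerDr !scalerA mulrC. Qed.
Let fr (a : A) : linear (fun b : B => kaug_eps hB b *: a).
Proof. by move=> c u v; rewrite kaug_eps_lin scalerDl scalerA. Qed.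

Fact base_eps_hom : alghom base_eps.
Proof.
apply: atens_lift_alghom => //; first by rewrite kaug_eps1 scale1r.
by move=> u u' v v'; rewrite kaug_epsM -scale_mull -scale_mulr scalerA.
Qed.

Lemma base_epsE a b : base_eps (atens a b) = kaug_eps hB b *: a.
Proof. exact: (tens_liftE fl fr). Qed.

Fact base_jK : cancel base_j base_eps.
Proof. by move=> a; rewrite base_epsE kaug_eps1 scale1r. Qed.

Fact base_plusP u : base_plus u <-> base_eps u = 0.
Proof.
have le := homL base_eps_hom; have lj := homL base_j_hom.
split=> [|e0].
  elim=> [|c v w [a [b [Bb ->]]] _ IH]; first exact: lin0.
  by rewrite le IH base_epsE kaug_eps_plus // scale0r scaler0 addr0.
rewrite -[u]subr0 -(lin0 lj) -e0; move: u {e0}; apply: atens_elim.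
  by rewrite (lin0 le) (lin0 lj) subr0; exact: lin_span0.
move=> c a b x IH; rewrite le lj opprD addrACA -scalerBr.
apply: lin_spanP IH; exists a, (b - kaug_eps hB b *: (1 : B)); split.
  exact: kaug_epsP.
rewrite (linB (atens_linr a)) (linZ (atens_linr a)) base_epsE /base_j.
by rewrite (linZ (atens_linl 1)).
Qed.

Definition base_alg : augalg A :=
  AugAlg base_j_hom base_eps_hom base_jK base_plusP.

End Base.

(* C (x) S(|_X^+_|_Omega), with augmentation part                             *)
(* C^+ (+) (C (x) S^+(|_X^+_|_Omega)). The copy |_V_|_w of V is the component *)
(* of index w of dsum Omega V.                                                *)
Section Step.
Variables (k : fieldType) (Omega : Type) (A : comAlg k) (C X : augalg A).

Definition step_sym : comAlg k := sym_alg (dsum Omega (aug_plusT X)).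
Local Notation S := step_sym.
Local Notation T := (tensor_alg C S).

Definition step_j (a : A) : T := atens (aug_j C a) 1.
Definition step_eps (x : T) : A :=
  tens_lift (fun (c : C) (s : S) => sym_eps s *: aug_eps C c) x.
Definition step_plus : set T :=
  lin_span ([set x | exists c : C, aug_plus C c /\ x = atens c 1] `|`
        [set x | exists (c : C) (s : S), sym_plus s /\ x = atens c s]).

Let lec := homL (aug_eps_hom C).
Let ljc := homL (aug_j_hom C).

Let fl (s : S) : linear (fun c : C => sym_eps s *: aug_eps C c).
Proof. by move=> c u v; rewrite lec scalerDr !scalerA mulrC. Qed.
Let fr (c : C) : linear (fun s : S => sym_eps s *: aug_eps C c).
Proof. by move=> a u v; rewrite sym_eps_lin scalerDl scalerA. Qed.

Fact step_j_hom : alghom step_j.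
Proof.
split=> [c u v|]; first by rewrite /step_j ljc atens_linl.
split=> [|u v]; first by rewrite /step_j (hom1 (aug_j_hom C)).
by rewrite /step_j (homM (aug_j_hom C)) atensM mulr1.
Qed.

Fact step_eps_hom : alghom step_eps.
Proof.
apply: atens_lift_alghom => //.
  by rewrite sym_eps1 (hom1 (aug_eps_hom C)) scale1r.
move=> u u' v v'.
by rewrite sym_epsM (homM (aug_eps_hom C)) -scale_mull -scale_mulr scalerA.
Qed.

Lemma step_epsE c s : step_eps (atens c s) = sym_eps s *: aug_eps C c.
Proof. exact: (tens_liftE fl fr). Qed.

Fact step_jK : cancel step_j step_eps.
Proof. by move=> a; rewrite step_epsE sym_eps1 scale1r aug_jK. Qed.

Fact step_plusP u : step_plus u <-> step_eps u = 0.
Proof.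
have le := homL step_eps_hom; have lj := homL step_j_hom.
split=> [|e0].
  elim=> [|c v w h _ IH]; first exact: lin0.
  rewrite le IH; case: h => [[d [/aug_plusP ed ->]]|[d [s [/sym_eps_plus es ->]]]].
    by rewrite step_epsE ed !scaler0 addr0.
  by rewrite step_epsE es scale0r scaler0 addr0.
rewrite -[u]subr0 -(lin0 lj) -e0; move: u {e0}; apply: atens_elim.
  by rewrite (lin0 le) (lin0 lj) subr0; exact: lin_span0.
move=> a c s x IH; rewrite le lj opprD addrACA -scalerBr.
set y := (Y in a *: Y + _).
pose s' := s - sym_eps s *: (1 : S).
pose c' := c - aug_j C (aug_eps C c).
have -> : y = sym_eps s *: atens c' 1 + atens c s'.
  rewrite /y /c' /s' (linB (atens_linr c)) (linZ (atens_linr c)).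
  rewrite (linB (atens_linl 1)) scalerBr step_epsE /step_j.
  by rewrite (linZ ljc) (linZ (atens_linl 1)) [RHS]addrC addrA subrK.
rewrite scalerDr scalerA -addrA; apply: lin_spanP; last apply: lin_spanP => //.
  by left; exists c'; split=> //; exact: aug_decomp.
by right; exists c, s'; split=> //; exact: sym_decomp.
Qed.

Definition step_alg : augalg A :=
  AugAlg step_j_hom step_eps_hom step_jK step_plusP.

Definition step_in (c : C) : step_alg := atens c 1.

Fact step_in_hom : alghom step_in.
Proof.
split; first exact: atens_linl.
by split=> // u v; rewrite /step_in [RHS]atensM mulr1.
Qed.
Fact step_in_eps c : aug_eps step_alg (step_in c) = aug_eps C c.
Proof. by rewrite /= /step_in step_epsE sym_eps1 scale1r. Qed.
Fact step_in_j a : step_in (aug_j C a) = aug_j step_alg a.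
Proof. by []. Qed.
Definition step_in_aug : aughom C step_alg := AugHom step_in_hom step_in_eps step_in_j.

Definition step_ret (x : step_alg) : C :=
  tens_lift (fun (c : C) (s : S) => sym_eps s *: c) x.

Let rl (s : S) : linear (fun c : C => sym_eps s *: c).
Proof. by move=> c u v; rewrite scalerDr !scalerA mulrC. Qed.
Let rr (c : C) : linear (fun s : S => sym_eps s *: c).
Proof. by move=> a u v; rewrite sym_eps_lin scalerDl scalerA. Qed.

Lemma step_retE c s : step_ret (atens c s) = sym_eps s *: c.
Proof. exact: (tens_liftE rl rr). Qed.
Fact step_ret_hom : alghom step_ret.
Proof.
apply: atens_lift_alghom => //; first by rewrite sym_eps1 scale1r.
by move=> u u' v v'; rewrite sym_epsM -scale_mull -scale_mulr scalerA.
Qed.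
Fact step_ret_eps x : aug_eps C (step_ret x) = aug_eps step_alg x.
Proof.
have lr := homL step_ret_hom; have le := homL (aug_eps_hom step_alg).
move: x; apply: atens_elim => [|d c s x IH].
  by rewrite (lin0 lr) (lin0 le) (lin0 lec).
rewrite lr le lec IH step_retE (linZ lec); congr (_ *: _ + _).
exact: esym (step_epsE c s).
Qed.
Fact step_ret_j a : step_ret (aug_j step_alg a) = aug_j C a.
Proof. by rewrite [LHS]step_retE sym_eps1 scale1r. Qed.
Definition step_ret_aug : aughom step_alg C :=
  AugHom step_ret_hom step_ret_eps step_ret_j.

Lemma step_inK : cancel step_in step_ret.
Proof. by move=> c; rewrite step_retE sym_eps1 scale1r. Qed.

(* u |-> 1 (x) |_u_|_omega *)
Definition bracket (w : Omega) (u : aug_plusT X) : step_alg :=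
  atens 1 (monom [:: dsum_in w u] : S).

Lemma bracket_linear w : linear (bracket w).
Proof.
by move=> c u v; rewrite /bracket dsum_in_linear monom_lin atens_linr.
Qed.

Lemma bracket_plus w u : aug_plus step_alg (bracket w u).
Proof.
apply: sub_lin_span; right; exists 1, (monom [:: dsum_in w u]); split=> //.
by apply: sub_lin_span; exists (dsum_in w u), [::].
Qed.

End Step.

Section StepMap.
Variables (k : fieldType) (Omega : Type) (A : comAlg k) (C X Y : augalg A).
Variable f : aughom X Y.
Local Notation stepX := (step_alg Omega C X).
Local Notation stepY := (step_alg Omega C Y).

(* id_C (x) S(|_f_|_Omega) *)
Definition step_sym_map : step_sym Omega X -> step_sym Omega Y :=
  sym_map (dsum_map (plus_map_linear f)).
Definition step_map (x : stepX) : stepY :=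
  tens_lift (fun (c : C) (s : step_sym Omega X) =>
    atens c (step_sym_map s) : tensor_alg _ _) x.

Let hs : alghom step_sym_map.
Proof. exact: sym_map_alghom (dsum_map_linear (plus_map_linear f)). Qed.

Let fl (s : step_sym Omega X) : linear (fun c : C => atens c (step_sym_map s)).
Proof. exact: atens_linl. Qed.
Let fr (c : C) :
  linear (fun s : step_sym Omega X => atens c (step_sym_map s)).
Proof. by move=> a u v; rewrite (homL hs) atens_linr. Qed.

Lemma step_mapE c s : step_map (atens c s) = atens c (step_sym_map s).
Proof. exact: (tens_liftE fl fr). Qed.

Fact step_map_hom : alghom step_map.
Proof.
apply: atens_lift_alghom => //; first by rewrite (hom1 hs).
by move=> u u' v v'; rewrite (homM hs) atensM.
Qed.

Fact step_map_eps u : aug_eps stepY (step_map u) = aug_eps stepX u.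
Proof.
have le := homL (aug_eps_hom stepX); have le' := homL (aug_eps_hom stepY).
have lm := homL step_map_hom.
move: u; apply: atens_elim => [|c d s x IH].
  by rewrite (lin0 lm) (lin0 le) (lin0 le').
rewrite lm le le' IH step_mapE; congr (_ *: _ + _).
rewrite [LHS]step_epsE [RHS]step_epsE; congr (_ *: _).
exact: (sym_eps_map (dsum_map_linear (plus_map_linear f))).
Qed.

Fact step_map_j a : step_map (aug_j stepX a) = aug_j stepY a.
Proof. by rewrite [LHS]step_mapE (hom1 hs). Qed.

Definition step_map_aug : aughom stepX stepY :=
  AugHom step_map_hom step_map_eps step_map_j.

Lemma step_map_bracket w u :
  step_map (bracket C w u) = bracket C w (plus_map f u).
Proof.
rewrite [LHS]step_mapE /bracket; congr atens.
rewrite [LHS](sym_map_monom (dsum_map_linear (plus_map_linear f))) /=.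
by rewrite dsum_map_in.
Qed.

End StepMap.

Lemma step_mapK (k : fieldType) (Omega : Type) (A : comAlg k) (C X Y : augalg A)
    (f : aughom X Y) (g : aughom Y X) :
  cancel f g ->
  cancel (@step_map k Omega A C X Y f) (@step_map k Omega A C Y X g).
Proof.
move=> fK.
have lf := homL (step_map_hom Omega C f); have lg := homL (step_map_hom Omega C g).
apply: atens_elim => [|d c s x IH]; first by rewrite (lin0 lf) (lin0 lg).
rewrite lf lg IH !step_mapE; congr (d *: atens c _ + x); move: s.
have ms := sym_map_monom (dsum_map_linear (I := Omega) (plus_map_linear f)).
have ms' := sym_map_monom (dsum_map_linear (I := Omega) (plus_map_linear g)).
have ls := sym_map_linear (dsum_map_linear (I := Omega) (plus_map_linear f)).
have ls' := sym_map_linear (dsum_map_linear (I := Omega) (plus_map_linear g)).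
apply: monom_elim => [|e s y IHs]; first by rewrite /step_sym_map (lin0 ls) (lin0 ls').
rewrite /step_sym_map in IHs *; rewrite ls ls' IHs ms ms' -map_comp.
rewrite (eq_map (g := id)) ?map_id // => u.
by apply: val_inj; apply: funext => i; apply: val_inj; exact: fK.
Qed.

Record dirsys (k : fieldType) := DirSys {
  ds_obj :> nat -> comAlg k;
  ds_map : forall n, ds_obj n -> ds_obj n.+1;
  ds_hom : forall n, alghom (@ds_map n)
}.

Section DirLim.
Variables (k : fieldType) (D : dirsys k).
Local Notation U := {n : nat & D n}.
Local Notation at_stage := (Tagged (fun n : nat => D n : Type)).

Definition ds_next (p : U) : U := at_stage (ds_map (tagged p)).

(* Two elements are identified when they have a common image. *)
Definition dl_eq (p q : U) : Prop :=
  exists d e, iter d ds_next p = iter e ds_next q.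
Definition dl_eqb : rel U := fun p q => `[< dl_eq p q >].

Fact dl_eqb_refl : reflexive dl_eqb.
Proof. by move=> p; apply/asboolP; exists 0%N, 0%N. Qed.
Fact dl_eqb_sym : symmetric dl_eqb.
Proof. by move=> p q; apply/asboolP/asboolP => -[d [e h]]; exists e, d. Qed.
Fact dl_eqb_trans : transitive dl_eqb.
Proof.
move=> q p r /asboolP[d [e h]] /asboolP[d' [e' h']]; apply/asboolP.
by exists (d' + d)%N, (e + e')%N; rewrite !iterD h -h' -!iterD addnC.
Qed.
Canonical dl_equiv := EquivRel dl_eqb dl_eqb_refl dl_eqb_sym dl_eqb_trans.

Definition dirlim := {eq_quot dl_eqb}.
HB.instance Definition _ := Choice.on dirlim.
HB.instance Definition _ := EqQuotient.on dirlim.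

Definition dl_class (p : U) : dirlim := \pi_dirlim p.
Definition dl_in (n : nat) (x : D n) : dirlim := dl_class (at_stage x).

Lemma dl_classP p q : dl_class p = dl_class q <-> dl_eq p q.
Proof. by split=> [/eqmodP/asboolP|pq] //; apply/eqmodP/asboolP. Qed.

Lemma dl_classK u : dl_class (repr u) = u.
Proof. exact: reprK. Qed.

Lemma dl_class_iter d p : dl_class (iter d ds_next p) = dl_class p.
Proof. by apply/dl_classP; exists 0%N, d. Qed.

Lemma tag_iter d p : tag (iter d ds_next p) = (d + tag p)%N.
Proof. by elim: d => //= d ->. Qed.

(* The image of p in D m, for tag p <= m. *)
Definition dl_at (m : nat) (p : U) : D m :=
  tagged_as (at_stage (0 : D m)) (iter (m - tag p) ds_next p).

Lemma dl_atP m p : (tag p <= m)%N -> at_stage (dl_at m p) = iter (m - tag p) ds_next p.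
Proof.
move=> pm; rewrite /dl_at; set q := iter _ _ _.
have: tag q = m by rewrite tag_iter subnK.
case: q => /= n x nm; case: m / nm {pm} => /=.
by rewrite tagged_asE.
Qed.

Lemma dl_at_class m p : (tag p <= m)%N -> dl_in (dl_at m p) = dl_class p.
Proof. by move=> pm; rewrite /dl_in dl_atP // dl_class_iter. Qed.

Fixpoint ds_up (d n : nat) (x : D n) : D (d + n)%N :=
  if d is d'.+1 then ds_map (ds_up d' x) else x.

Lemma ds_upE d n (x : D n) : iter d ds_next (at_stage x) = at_stage (ds_up d x).
Proof. by elim: d => //= d ->. Qed.

Lemma ds_up_hom d n : alghom (@ds_up d n).
Proof.
elim: d => [|d IH] /=; first by split.
have h := @ds_hom k D (d + n)%N; split=> [c u v|].
  by rewrite (homL IH) (homL h).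
by split=> [|u v]; rewrite ?(hom1 IH, hom1 h, homM IH, homM h).
Qed.

(* Any operation natural in the stage is compatible with the identifications. *)
Lemma dl_inj2 (F : forall n, D n -> D n -> D n) :
  (forall n (x y : D n), ds_map (F n x y) = F n.+1 (ds_map x) (ds_map y)) ->
  forall n m (x y : D n) (x' y' : D m),
  dl_in x = dl_in x' -> dl_in y = dl_in y' -> dl_in (F n x y) = dl_in (F m x' y').
Proof.
move=> FE n m x y x' y' /dl_classP[d [e h]] /dl_classP[d' [e' h']].
have upF i l (u v : D l) : ds_up i (F l u v) = F _ (ds_up i u) (ds_up i v).
  by elim: i => //= i ->; exact: FE.
apply/dl_classP.
have tE : (d + n = e + m)%N by have := congr1 tag h; rewrite !tag_iter.
have tE' : (d' + n = e' + m)%N by have := congr1 tag h'; rewrite !tag_iter.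
exists (d' + d)%N, (d' + e)%N; rewrite !ds_upE !upF.
have {}h : at_stage (ds_up (d' + d) x) = at_stage (ds_up (d' + e) x').
  by rewrite -!ds_upE !iterD h.
have {}h' : at_stage (ds_up (d' + d) y) = at_stage (ds_up (d' + e) y').
  have de : (d' + e = d + e')%N.
    by apply: (@addIn m); rewrite -!addnA -tE -tE' addnCA.
  by rewrite -!ds_upE de addnC !iterD h'.
move: (ds_up _ x) (ds_up _ y) (ds_up _ x') (ds_up _ y') h h'.
have : (d' + d + n = d' + e + m)%N by rewrite -!addnA tE.
move: (d' + d + n)%N (d' + e + m)%N => i l il; case: l / il => a b a' b'.
by move=> ha hb; rewrite (eq_from_Tagged ha) (eq_from_Tagged hb).
Qed.

Definition dl_op (F : forall n, D n -> D n -> D n) (u v : dirlim) : dirlim :=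
  let p := repr u in let q := repr v in
  let m := maxn (tag p) (tag q) in dl_in (F m (dl_at m p) (dl_at m q)).

Lemma dl_opE (F : forall n, D n -> D n -> D n) :
  (forall n (x y : D n), ds_map (F n x y) = F n.+1 (ds_map x) (ds_map y)) ->
  forall n (x y : D n), dl_op F (dl_in x) (dl_in y) = dl_in (F n x y).
Proof.
move=> FE n x y; rewrite /dl_op; apply: dl_inj2 => //.
  by rewrite dl_at_class ?leq_maxl // dl_classK.
by rewrite dl_at_class ?leq_maxr // dl_classK.
Qed.

Definition dl_add := dl_op (fun n (x y : D n) => x + y).
Definition dl_mul := dl_op (fun n (x y : D n) => x * y).
Definition dl_scale (c : k) (u : dirlim) : dirlim := dl_in (c *: tagged (repr u)).
Definition dl_opp : dirlim -> dirlim := dl_scale (-1).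
Definition dl_zero : dirlim := dl_in (0 : D 0%N).
Definition dl_one : dirlim := dl_in (1 : D 0%N).

Lemma dl_addE n (x y : D n) : dl_add (dl_in x) (dl_in y) = dl_in (x + y).
Proof. by apply: dl_opE => {}n {}x {}y; rewrite (linD (homL (@ds_hom k D n))). Qed.
Lemma dl_mulE n (x y : D n) : dl_mul (dl_in x) (dl_in y) = dl_in (x * y).
Proof. by apply: dl_opE => {}n {}x {}y; rewrite (homM (@ds_hom k D n)). Qed.
Lemma dl_scaleE c n (x : D n) : dl_scale c (dl_in x) = dl_in (c *: x).
Proof.
have E : dl_in (tagged (repr (dl_in x))) = dl_in x.
  by rewrite -[RHS]dl_classK; case: (repr _).
have lF l (y z : D l) : ds_map (c *: y) = c *: ds_map y.
  exact: linZ (homL (@ds_hom k D l)) c y.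
exact: (dl_inj2 (F := fun n (x _ : D n) => c *: x) lF E E).
Qed.

Lemma dl_in_map n (x : D n) : dl_in (ds_map x) = dl_in x.
Proof. exact: (dl_class_iter 1 (at_stage x)). Qed.

Lemma dl_zeroE n : dl_zero = dl_in (0 : D n).
Proof.
by elim: n => // n ->; rewrite -dl_in_map (lin0 (homL (@ds_hom k D n))).
Qed.
Lemma dl_oneE n : dl_one = dl_in (1 : D n).
Proof. by elim: n => // n ->; rewrite -dl_in_map (hom1 (@ds_hom k D n)). Qed.

Lemma dl_elim1 (P : dirlim -> Prop) :
  (forall n (x : D n), P (dl_in x)) -> forall u, P u.
Proof. by move=> h u; rewrite -[u]dl_classK; case: (repr u). Qed.

Lemma dl_elim2 (P : dirlim -> dirlim -> Prop) :
  (forall n (x y : D n), P (dl_in x) (dl_in y)) -> forall u v, P u v.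
Proof.
move=> h u v; rewrite -[u]dl_classK -[v]dl_classK.
have [ul vl] := (leq_maxl (tag (repr u)) (tag (repr v)),
                 leq_maxr (tag (repr u)) (tag (repr v))).
by rewrite -(dl_at_class ul) -(dl_at_class vl).
Qed.

Lemma dl_elim3 (P : dirlim -> dirlim -> dirlim -> Prop) :
  (forall n (x y z : D n), P (dl_in x) (dl_in y) (dl_in z)) -> forall u v w, P u v w.
Proof.
move=> h u v; move: u v; apply: dl_elim2 => n x y; elim/dl_elim1=> m z.
have [nl ml] := (leq_maxl n m, leq_maxr n m).
rewrite -[dl_in x](@dl_at_class _ (at_stage x) nl) -[dl_in y](@dl_at_class _ (at_stage y) nl).
by rewrite -[dl_in z](@dl_at_class _ (at_stage z) ml).
Qed.

Fact dl_addA : associative dl_add.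
Proof. by apply: dl_elim3 => n x y z; rewrite !dl_addE addrA. Qed.
Fact dl_addC : commutative dl_add.
Proof. by apply: dl_elim2 => n x y; rewrite !dl_addE addrC. Qed.
Fact dl_add0 : left_id dl_zero dl_add.
Proof. by elim/dl_elim1=> n x; rewrite (dl_zeroE n) dl_addE add0r. Qed.
Fact dl_addN : left_inverse dl_zero dl_opp dl_add.
Proof.
elim/dl_elim1=> n x.
by rewrite (dl_zeroE n) [dl_opp _]dl_scaleE dl_addE scaleN1r addNr.
Qed.
HB.instance Definition _ :=
  GRing.isZmodule.Build dirlim dl_addA dl_addC dl_add0 dl_addN.

Fact dl_scaleA a b v : dl_scale a (dl_scale b v) = dl_scale (a * b) v.
Proof. by elim/dl_elim1: v => n x; rewrite !dl_scaleE scalerA. Qed.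
Fact dl_scale1 : left_id 1 dl_scale.
Proof. by elim/dl_elim1=> n x; rewrite dl_scaleE scale1r. Qed.
Fact dl_scaleDr : right_distributive dl_scale +%R.
Proof.
move=> c; apply: dl_elim2 => n x y.
by rewrite [_ + _]dl_addE !dl_scaleE [RHS]dl_addE scalerDr.
Qed.
Fact dl_scaleDl v : {morph dl_scale^~ v : a b / a + b}.
Proof.
by move=> a b; elim/dl_elim1: v => n x; rewrite !dl_scaleE [RHS]dl_addE scalerDl.
Qed.
HB.instance Definition _ := GRing.Zmodule_isLmodule.Build k dirlim
  dl_scaleA dl_scale1 dl_scaleDr dl_scaleDl.

Fact dl_mulA : associative dl_mul.
Proof. by apply: dl_elim3 => n x y z; rewrite !dl_mulE mulrA. Qed.
Fact dl_mulC : commutative dl_mul.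
Proof. by apply: dl_elim2 => n x y; rewrite !dl_mulE mulrC. Qed.
Fact dl_mul1 : left_id dl_one dl_mul.
Proof. by elim/dl_elim1=> n x; rewrite (dl_oneE n) dl_mulE mul1r. Qed.
Fact dl_mulDl : left_distributive dl_mul +%R.
Proof.
by apply: dl_elim3 => n x y z; rewrite [_ + _]dl_addE !dl_mulE [RHS]dl_addE mulrDl.
Qed.
Fact dl_scale_mull c u v : c *: dl_mul u v = dl_mul (c *: u) v.
Proof.
move: u v; apply: dl_elim2 => n x y.
by rewrite dl_mulE [LHS]dl_scaleE [c *: _]dl_scaleE dl_mulE scale_mull.
Qed.

Definition dirlim_alg : comAlg k :=
  @ComAlg k dirlim dl_one dl_mul dl_mulA dl_mulC dl_mul1 dl_mulDl dl_scale_mull.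

Definition incl (n : nat) (x : D n) : dirlim_alg := dl_in x.

Lemma incl_hom n : alghom (@incl n).
Proof.
split=> [c u v|].
  have h : dl_add (dl_scale c (dl_in u)) (dl_in v) = dl_in (c *: u + v).
    by rewrite dl_scaleE dl_addE.
  exact: esym h.
split=> [|u v]; first exact: esym (dl_oneE n).
exact: esym (dl_mulE u v).
Qed.

Lemma incl_map n (x : D n) : incl (ds_map x) = incl x.
Proof. exact: dl_in_map. Qed.

Lemma incl_eq n m (x : D n) (y : D m) :
  incl x = incl y <-> dl_eq (at_stage x) (at_stage y).
Proof. exact: dl_classP. Qed.

Lemma incl_surj (u : dirlim_alg) : exists n (x : D n), u = incl x.
Proof. by elim/dl_elim1: u => n x; exists n, x. Qed.

End DirLim.

Section FreeConstruction.
Variables (k : fieldType) (Omega : Type) (A B : comAlg k).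
Variables (Bp : set B) (hB : augmented Bp).

Fixpoint stage (n : nat) : augalg A :=
  if n is m.+1 then step_alg Omega (base_alg A hB) (stage m) else base_alg A hB.

Fixpoint stage_map (n : nat) : aughom (stage n) (stage n.+1) :=
  match n return aughom (stage n) (stage n.+1) with
  | 0 => step_in_aug Omega (base_alg A hB) (base_alg A hB)
  | m.+1 => step_map_aug Omega (base_alg A hB) (stage_map m)
  end.

Lemma stage_map_inj n : injective (stage_map n).
Proof.
suff [r rK] : exists r : aughom (stage n.+1) (stage n), cancel (stage_map n) r.
  exact: can_inj rK.
elim: n => [|n [r rK]]; last by exists (step_map_aug Omega _ r); exact: step_mapK.
by exists (step_ret_aug Omega (base_alg A hB) (base_alg A hB)); exact: step_inK.
Qed.

Definition stage_sys : dirsys k :=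
  @DirSys k stage stage_map (fun n => aughom_hom (stage_map n)).

Definition frakI : comAlg k := dirlim_alg stage_sys.

Definition frakI_incl (n : nat) (x : stage n) : frakI := @incl k stage_sys n x.

Lemma frakI_incl_inj n : injective (@frakI_incl n).
Proof.
move=> x y /incl_eq[d [e]]; rewrite !ds_upE => h.
have de : d = e by apply: (@addIn n); have := congr1 tag h.
rewrite -de in h; have {h} := eq_from_Tagged h.
by elim: d {e de} => //= d IH h; apply: IH; exact: stage_map_inj h.
Qed.

Definition frakI_plus : set frakI :=
  [set x | exists n (u : stage n), aug_plus (stage n) u /\ x = frakI_incl u].

Definition frakI_A (a : A) : frakI := @frakI_incl 0 (atens a 1).
Definition frakI_B (b : B) : frakI := @frakI_incl 0 (atens 1 b).

Variable rho : Omega -> A -> A.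

(* Pi_w(a) = rho_w(a) for a in A and Pi_w(u) = |_u_|_w for u in I^+, where    *)
(* x = aug_eps x + aug_proj x in A (+) I_n^+ for x in I_n.                    *)
Definition stage_Pi (w : Omega) (n : nat) (x : stage n) : stage n.+1 :=
  aug_j (stage n.+1) (rho w (aug_eps (stage n) x)) +
  bracket (base_alg A hB) w (aug_proj x).
Definition frakI_Pi (w : Omega) (x : frakI) : frakI :=
  frakI_incl (stage_Pi w (tagged (repr (x : dirlim stage_sys)))).

Lemma stage_map_Pi w n (x : stage n) :
  stage_map n.+1 (stage_Pi w x) = stage_Pi w (stage_map n x).
Proof.
rewrite /stage_Pi (linD (homL (aughom_hom _))) aughom_j aughom_eps.
by rewrite [X in _ + X]step_map_bracket plus_map_proj.
Qed.

Lemma frakI_repr (T : Type) (F : forall n, stage n -> T) :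
  (forall n (x : stage n), F n.+1 (stage_map n x) = F n x) ->
  forall n (x : stage n),
  F _ (tagged (repr (frakI_incl x : dirlim stage_sys))) = F n x.
Proof.
move=> FE n x; set S := stage_sys; pose G (p : {n : nat & S n}) := F _ (tagged p).
have GI d p : G (iter d (@ds_next k S) p) = G p.
  by elim: d => //= d <-; exact: FE.
have /dl_classP[d [e h]] := dl_classK (@dl_in k S n x).
by rewrite -[LHS](GI d) h GI.
Qed.

Lemma frakI_PiE w n (x : stage n) : frakI_Pi w (frakI_incl x) = frakI_incl (stage_Pi w x).
Proof.
apply: (frakI_repr (F := fun n x => frakI_incl (stage_Pi w x))) => {}n {}x.
by rewrite -stage_map_Pi; exact: (@incl_map k stage_sys).
Qed.

Lemma frakI_A_incl n a : frakI_A a = frakI_incl (aug_j (stage n) a).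
Proof.
elim: n => // n ->; rewrite -(aughom_j (stage_map n)).
exact/esym/(@incl_map k stage_sys).
Qed.

Lemma frakI_Pi_A w a :
  frakI_Pi w (frakI_A a) = frakI_A (rho w a).
Proof.
rewrite (frakI_A_incl 0) frakI_PiE /stage_Pi aug_jK aug_proj_j.
by rewrite (lin0 (bracket_linear _ w)) addr0 -frakI_A_incl.
Qed.

Lemma frakI_Pi_plus w n (u : aug_plusT (stage n)) : (forall w, linear (rho w)) ->
  frakI_Pi w (frakI_incl (submod_val u)) =
  @frakI_incl n.+1 (bracket (base_alg A hB) w u).
Proof.
move=> lr; rewrite frakI_PiE /stage_Pi aug_proj_id.
have /aug_plusP -> := submod_valP u.
by rewrite (lin0 (lr w)) (lin0 (homL (aug_j_hom _))) add0r.
Qed.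

Lemma frakI_direct (x : frakI) :
  exists! av : A * frakI, frakI_plus av.2 /\ x = frakI_A av.1 + av.2.
Proof.
pose ep (y : frakI) := aug_eps (stage _) (tagged (repr (y : dirlim stage_sys))).
have epE n (u : stage n) : ep (frakI_incl u) = aug_eps (stage n) u.
  apply: (frakI_repr (F := fun n => aug_eps (stage n))) => {}n {}u.
  exact: aughom_eps (stage_map n) u.
have epD a v : frakI_plus v -> ep (frakI_A a + v) = a.
  move=> [n [u [/aug_plusP eu ->]]]; rewrite (frakI_A_incl n).
  rewrite -(linD (homL (@incl_hom k stage_sys n))) [LHS]epE.
  by rewrite (linD (homL (aug_eps_hom _))) aug_jK eu addr0.
have [n [u ->]] := incl_surj x.
exists (aug_eps (stage n) u,
  frakI_incl (u - aug_j (stage n) (aug_eps (stage n) u))); split=> /=.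
  split; first by exists n, (u - aug_j (stage n) (aug_eps (stage n) u));
    split=> //; exact: aug_decomp.
  rewrite (frakI_A_incl n) -(linD (homL (@incl_hom k stage_sys n))).
  by rewrite subrKC.
case=> a v /= [pv E]; have ea : aug_eps (stage n) u = a.
  by rewrite -(epD a v pv) -E; exact/esym/epE.
rewrite ea; congr pair; rewrite /frakI_incl.
rewrite (linB (homL (@incl_hom k stage_sys n))) E.
by rewrite -[X in _ - X](frakI_A_incl n) addrAC subrr add0r.
Qed.

End FreeConstruction.

Section Operated.
Variables (k : fieldType) (Omega : Type).

Definition operated (V : comAlg k) (P : Omega -> V -> V) : Prop :=
  forall w, linear (P w).

Definition operated_hom (V U : comAlg k) (P : Omega -> V -> V)
    (Q : Omega -> U -> U) (f : V -> U) : Prop :=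
  alghom f /\ forall w x, f (P w x) = Q w (f x).

Definition operated_over (A : comAlg k) (rho : Omega -> A -> A)
    (R : comAlg k) (P : Omega -> R -> R) (jR : A -> R) : Prop :=
  operated P /\ operated_hom rho P jR.

Definition operated_over_hom (A : comAlg k)
    (R : comAlg k) (P : Omega -> R -> R) (jR : A -> R)
    (S : comAlg k) (Q : Omega -> S -> S) (jS : A -> S) (f : R -> S) : Prop :=
  operated_hom P Q f /\ forall a, f (jR a) = jS a.

Definition is_free_over (A : comAlg k) (rho : Omega -> A -> A) (B : comAlg k)
    (F : comAlg k) (Pi : Omega -> F -> F) (jF : A -> F) (iB : B -> F) : Prop :=
  [/\ operated_over rho Pi jF,
      alghom iB &
      forall (R : comAlg k) (P : Omega -> R -> R) (jR : A -> R),
        operated_over rho P jR ->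
        forall f : B -> R, alghom f ->
        exists! fbar : F -> R,
          operated_over_hom Pi jF P jR fbar /\ forall b, fbar (iB b) = f b].

End Operated.

(* Main.v *)
Require Import Defs.
From mathcomp Require Import all_boot all_algebra.
From mathcomp Require Import boolp classical_sets.
From mathcomp Require Import cardinality fsbigop.

Set Implicit Arguments.
Unset Strict Implicit.
Unset Printing Implicit Defensive.

Import GRing.Theory.
Local Open Scope ring_scope.

(** Each ingredient of a stage [C (x) S(|_X^+_|_Omega)] has a universal
    property: the tensor product of algebras is their coproduct, S(V) is the
    free commutative algebra on the module V, and a direct sum is a coproduct
    of modules. Together they say that an algebra homomorphism from the stage
    to an algebra W is the same as an algebra homomorphism [C -> W] and a
    family, indexed by Omega, of linear maps [X^+ -> W], prescribed on the
    brackets [|_u_|_w] ([step_lift] for existence, [step_ext] for uniqueness).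

    Given [jR : A -> R] and [f : B -> R], the map on [I_0 = A (x) B] must be
    [a (x) b |-> jR a * f b], and on the next stage compatibility with the
    operators forces the bracket of u to go to P_w of the image of u. So there
    is exactly one candidate on every I_n, built by recursion ([stage_lift]);
    uniqueness on each stage also makes the candidates compatible with the
    inclusions ([stage_lift_map]), and they glue to the limit ([frakI_lift]).
    The same uniqueness determines the map out of the limit ([frakI_ext]).

    On [u = a + v] in [A (+) I^+] the operator is [rho_w a + |_v|_w], whose
    image is the sum of [jR (rho_w a)] and P_w of the image of v; since jR
    commutes with the operators and P_w is additive, this is P_w of the image
    of u ([frakI_lift_Pi]). *)

(** * Linear maps out of a direct sum *)

Section DirectSumLift.
Variables (k : fieldType) (I : Type) (V W : lmodType k).

Lemma dsum_support (u : dsum I V) :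
  exists r : seq {classic I},
    uniq r /\ forall i, i \notin r -> submod_val u i = 0.
Proof.
have /(@finite_seqP {classic I})[s sE] := submod_valP u.
exists (undup s); split=> [|i]; first exact: undup_uniq.
rewrite mem_undup; apply: contraNeq => ui.
by have : [set` s]%classic i by rewrite -sE.
Qed.

Section Lift.
Variables (h : I -> V -> W) (lh : forall i, linear (h i)).

(** The index type is arbitrary, so it is given a classical choice structure in
    order to form a finitely supported sum over it. *)
Definition dsum_lift (u : dsum I V) : W :=
  \sum_(i \in [set: {classic I}]) h i (submod_val u i).

(** The list may be larger than the support, so that two elements can be summed
    over one common list: this is how linearity is obtained. *)
Lemma dsum_lift_seq (r : seq {classic I}) (u : dsum I V) :
  uniq r -> (forall i, i \notin r -> submod_val u i = 0) ->
  dsum_lift u = \sum_(i <- r) h i (submod_val u i).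
Proof.
move=> ur u0; rewrite /dsum_lift (@fsbigE _ _ _ _ _ r) //.
  by apply: eq_bigl => i; rewrite in_setT.
by move=> i _ ir; rewrite u0 // (lin0 (lh i)).
Qed.

Lemma dsum_lift_linear : linear dsum_lift.
Proof.
move=> c u v.
have [[r [_ ru]] [s [_ sv]]] := (dsum_support u, dsum_support v).
have ut := undup_uniq (r ++ s); set t := undup _ in ut.
have tr i : i \notin t -> submod_val u i = 0.
  by rewrite mem_undup mem_cat negb_or => /andP[/ru].
have ts i : i \notin t -> submod_val v i = 0.
  by rewrite mem_undup mem_cat negb_or => /andP[_ /sv].
have tE i :
  submod_val (c *: u + v) i = c *: submod_val u i + submod_val v i by [].
rewrite !(@dsum_lift_seq t) //; last first.
  by move=> i it; rewrite tE tr // ts // scaler0 addr0.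
rewrite scaler_sumr -big_split; apply: eq_bigr => i _.
by rewrite tE lh.
Qed.

Lemma dsum_liftE i v : dsum_lift (dsum_in i v) = h i v.
Proof.
rewrite (@dsum_lift_seq [:: i]) //.
  by rewrite big_seq1 /= /delta_fun; case: pselect.
move=> j; rewrite inE => ji; rewrite /= /delta_fun.
by case: pselect => // e; rewrite e eqxx in ji.
Qed.

End Lift.

(** An element of the direct sum is the finite sum of its components over its
    support. *)
Lemma dsum_ext (f g : dsum I V -> W) : linear f -> linear g ->
  (forall i v, f (dsum_in i v) = g (dsum_in i v)) -> f =1 g.
Proof.
move=> lf lg fg u; have [r [ur u0]] := dsum_support u.
have -> : u = \sum_(i <- r) dsum_in i (submod_val u i).
  apply: val_inj; apply: funext => j /=.
  have -> : val (\sum_(i <- r) dsum_in i (submod_val u i)) j =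
      \sum_(i <- r) delta_fun i (submod_val u i) j.
    elim: (r) => [|i s IH]; first by rewrite !big_nil.
    by rewrite !big_cons -IH.
  have [jr|jr] := boolP ((j : {classic I}) \in r).
    rewrite (bigD1_seq (j : {classic I})) //= big1 ?addr0 /delta_fun => [|i ij].
      by case: pselect.
    by case: pselect => // ji; rewrite ji eqxx in ij.
  rewrite u0 // big_seq big1 // => i ir; rewrite /delta_fun.
  by case: pselect => // ji; rewrite ji ir in jr.
elim: r {ur u0} => [|i r IH]; first by rewrite big_nil (lin0 lf) (lin0 lg).
by rewrite big_cons (linD lf) (linD lg) fg IH.
Qed.

End DirectSumLift.

(** * Algebra homomorphisms out of symmetric algebras and tensor products *)

Section SymmetricLift.
Variables (k : fieldType) (V : lmodType k) (W : comAlg k).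

Definition sym_alg_lift (f : V -> W) : sym_alg V -> W :=
  plift (fun s => \prod_(v <- s) f v).

Section Lift.
Variables (f : V -> W) (lf : linear f).

Let prod_perm (s t : seq V) :
  perm_eq s t -> \prod_(v <- s) f v = \prod_(v <- t) f v :> W.
Proof. exact: perm_big. Qed.
Let prod_lin (s : seq V) : linear (fun u => \prod_(v <- u :: s) f v : W).
Proof. by move=> c u v; rewrite !big_cons lf mulrDl scale_mull. Qed.

Lemma sym_alg_lift_linear : linear (sym_alg_lift f).
Proof. exact: sym_lift_linear prod_perm prod_lin. Qed.

Lemma sym_alg_lift_monom s : sym_alg_lift f (monom s) = \prod_(v <- s) f v.
Proof. exact: (sym_liftE prod_perm prod_lin). Qed.

Lemma sym_alg_lift_hom : alghom (sym_alg_lift f).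
Proof.
have lin := sym_alg_lift_linear.
split=> //; split=> [|x y].
  by rewrite -monom_nil sym_alg_lift_monom big_nil.
elim/monom_elim: x => [|c s x IH]; first by rewrite mul0r (lin0 lin) mul0r.
rewrite mulrDl -scale_mull !lin IH mulrDl -scale_mull; congr (c *: _ + _).
elim/monom_elim: y {IH} => [|d t y IH]; first by rewrite mulr0 (lin0 lin) mulr0.
rewrite mulrDr -scale_mulr !lin IH mulrDr -scale_mulr; congr (d *: _ + _).
by rewrite -monom_cat !sym_alg_lift_monom big_cat.
Qed.

End Lift.

(** Monomials are products of monomials of length one, and they span S(V). *)
Lemma sym_ext (f g : sym_alg V -> W) : alghom f -> alghom g ->
  (forall v, f (monom [:: v]) = g (monom [:: v])) -> f =1 g.
Proof.
move=> hf hg fg; apply: pres_lin_ext (homL hf) (homL hg) _.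
elim=> [|v s IH]; first by rewrite [LHS](hom1 hf) [RHS](hom1 hg).
have e : pgen (@sym_rel k V) (v :: s) = monom [:: v] * monom s.
  exact: (monom_cat [:: v] s).
by rewrite e (homM hf) (homM hg) fg; congr (_ * _); exact: IH.
Qed.

End SymmetricLift.

Section TensorLift.
Variables (k : fieldType) (U V W : comAlg k).

Definition tensor_lift (f : U -> W) (g : V -> W) : tensor_alg U V -> W :=
  tens_lift (fun u v => f u * g v).

Section Lift.
Variables (f : U -> W) (g : V -> W) (hf : alghom f) (hg : alghom g).

Let fl (v : V) : linear (fun u : U => f u * g v).
Proof. by move=> c x y; rewrite (homL hf) mulrDl scale_mull. Qed.
Let fr (u : U) : linear (fun v : V => f u * g v).
Proof. by move=> c x y; rewrite (homL hg) mulrDr scale_mulr. Qed.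

Lemma tensor_liftE u v : tensor_lift f g (atens u v) = f u * g v.
Proof. exact: (tens_liftE fl fr). Qed.

Lemma tensor_lift_hom : alghom (tensor_lift f g).
Proof.
apply: atens_lift_alghom => //; first by rewrite (hom1 hf) (hom1 hg) mulr1.
by move=> u u' v v'; rewrite (homM hf) (homM hg) mulrACA.
Qed.

End Lift.

(** [u (x) v] is the product of [u (x) 1] and [1 (x) v]. *)
Lemma tensor_ext (f g : tensor_alg U V -> W) : alghom f -> alghom g ->
  (forall u, f (atens u 1) = g (atens u 1)) ->
  (forall v, f (atens 1 v) = g (atens 1 v)) -> f =1 g.
Proof.
move=> hf hg fgl fgr; apply: tens_ext (homL hf) (homL hg) _ => u v.
have -> : tens u v = atens u 1 * atens 1 v by rewrite atensM mulr1 mul1r.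
by rewrite (homM hf) (homM hg) fgl fgr.
Qed.

End TensorLift.

Lemma alghom_comp (k : fieldType) (U V W : comAlg k) (f : U -> V) (g : V -> W) :
  alghom f -> alghom g -> alghom (g \o f).
Proof.
move=> hf hg; split=> [c u v|]; first by rewrite /= (homL hf) (homL hg).
split=> [|u v] /=; first by rewrite (hom1 hf) (hom1 hg).
by rewrite (homM hf) (homM hg).
Qed.

Lemma atens1l_hom (k : fieldType) (U V : comAlg k) :
  alghom (fun v : V => atens (1 : U) v).
Proof.
split; first exact: atens_linr.
by split=> // u v; rewrite atensM mulr1.
Qed.

(** * Algebra homomorphisms out of one step of the construction *)

Section StepLift.
Variables (k : fieldType) (Omega : Type) (A : comAlg k) (C X : augalg A).
Variable W : comAlg k.

Definition step_lift (g : C -> W) (h : Omega -> aug_plusT X -> W) :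
    step_alg Omega C X -> W :=
  tensor_lift g (sym_alg_lift (dsum_lift h)).

Section Lift.
Variables (g : C -> W) (h : Omega -> aug_plusT X -> W).
Hypotheses (hg : alghom g) (lh : forall w, linear (h w)).

Let hs : alghom (sym_alg_lift (dsum_lift h)).
Proof. exact: sym_alg_lift_hom (dsum_lift_linear lh). Qed.

Lemma step_lift_hom : alghom (step_lift g h).
Proof. exact: tensor_lift_hom. Qed.

Lemma step_lift_in c : step_lift g h (step_in Omega X c) = g c.
Proof. by rewrite [LHS](tensor_liftE hg hs) (hom1 hs) mulr1. Qed.

Lemma step_lift_bracket w u : step_lift g h (bracket C w u) = h w u.
Proof.
rewrite [LHS](tensor_liftE hg hs) (hom1 hg) mul1r.
by rewrite (sym_alg_lift_monom (dsum_lift_linear lh)) big_seq1 dsum_liftE.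
Qed.

End Lift.

(** The uniqueness half of the universal property of [C (x) S(|_X^+_|_Omega)].
    It drives both the gluing of the stagewise lifts and the uniqueness of the
    map out of the limit. *)
Lemma step_ext (f g : step_alg Omega C X -> W) : alghom f -> alghom g ->
  (forall c, f (step_in Omega X c) = g (step_in Omega X c)) ->
  (forall w u, f (bracket C w u) = g (bracket C w u)) -> f =1 g.
Proof.
move=> hf hg fgC fgX; apply: tensor_ext (hf) (hg) fgC _.
have h1 := @atens1l_hom k C (step_sym Omega X).
apply: sym_ext (alghom_comp h1 hf) (alghom_comp h1 hg) _.
have lin (e : step_alg Omega C X -> W) : alghom e ->
    linear (fun v => e (atens (1 : C) (monom [:: v]))).
  by move=> he c u v; rewrite monom_lin atens_linr (homL he).
exact: dsum_ext (lin f hf) (lin g hg) fgX.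
Qed.

End StepLift.

(** * The limit algebra and its universal property *)

Section FrakI.
Variables (k : fieldType) (Omega : Type) (A B : comAlg k).
Variables (Bp : set B) (hB : augmented Bp).
Local Notation stage := (stage Omega A hB).
Local Notation base := (base_alg A hB).
Local Notation I := (frakI Omega A hB).
Local Notation I_incl n := (@frakI_incl k Omega A B Bp hB n).

Lemma frakI_incl_hom n : alghom (I_incl n).
Proof. exact: (@incl_hom k (stage_sys Omega A hB) n). Qed.

Lemma frakI_incl_map n (x : stage n) :
  I_incl n.+1 (stage_map Omega A hB n x) = I_incl n x.
Proof. exact: (@incl_map k (stage_sys Omega A hB)). Qed.

(** The transition maps are [id_C (x) S(..)], so they fix the factor C; hence
    the copies of C in all the stages coincide in the limit. *)
Lemma stage_map_in n (c : base) :
  stage_map Omega A hB n.+1 (step_in Omega (stage n) c) =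
  step_in Omega (stage n.+1) c.
Proof.
rewrite [LHS]step_mapE /step_in; congr atens; apply/hom1.
exact: sym_map_alghom (dsum_map_linear (plus_map_linear _)).
Qed.

Lemma frakI_incl_step_in n (c : base) :
  I_incl n.+1 (step_in Omega (stage n) c) = I_incl 0 c.
Proof.
elim: n => [|n IH]; first exact: (frakI_incl_map (c : stage 0)).
rewrite -IH -[RHS]frakI_incl_map; congr frakI_incl.
exact/esym/stage_map_in.
Qed.

Lemma frakI_elim2 (P : I -> I -> Prop) :
  (forall n (x y : stage n), P (I_incl n x) (I_incl n y)) -> forall u v, P u v.
Proof. exact: (@dl_elim2 k (stage_sys Omega A hB)). Qed.

Lemma frakI_elim (P : I -> Prop) :
  (forall n (x : stage n), P (I_incl n x)) -> forall u, P u.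
Proof. exact: (@dl_elim1 k (stage_sys Omega A hB)). Qed.

Lemma frakI_A_hom : alghom (@frakI_A k Omega A B Bp hB).
Proof. exact: alghom_comp (aug_j_hom base) (frakI_incl_hom 0). Qed.

Lemma frakI_B_hom : alghom (@frakI_B k Omega A B Bp hB).
Proof. exact: alghom_comp (@atens1l_hom k A B) (frakI_incl_hom 0). Qed.

Variables (rho : Omega -> A -> A) (hrho : operated rho).
Local Notation Pi := (@frakI_Pi k Omega A B Bp hB rho).

Lemma frakI_Pi_linear w : linear (Pi w).
Proof.
move=> c; apply: frakI_elim2 => n x y.
have hn := homL (frakI_incl_hom n); have hn1 := homL (frakI_incl_hom n.+1).
rewrite -hn !frakI_PiE -hn1; congr (I_incl _ _); rewrite /stage_Pi.
rewrite (homL (aug_eps_hom _)) hrho (homL (aug_j_hom _)) aug_proj_linear.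
by rewrite bracket_linear scalerDr addrACA.
Qed.

Section Lift.
Variables (R : comAlg k) (P : Omega -> R -> R) (jR : A -> R).
Hypothesis hR : operated_over rho P jR.
Variables (f : B -> R) (hf : alghom f).

Let lP w : linear (P w). Proof. by case: hR. Qed.
Let hj : alghom jR. Proof. by case: hR => _ []. Qed.

(** The only possible values: the factor C of each stage comes from [I_0], and
    the bracket of u must go to P_w of the image of u. *)
Fixpoint stage_lift (n : nat) : stage n -> R :=
  match n return stage n -> R with
  | 0 => tensor_lift jR f
  | m.+1 => step_lift (tensor_lift jR f : base -> R)
              (fun w (u : aug_plusT (stage m)) =>
                 P w (stage_lift (submod_val u)))
  end.

Lemma stage_lift_hom n : alghom (@stage_lift n).
Proof.
elim: n => [|n IH]; first exact: tensor_lift_hom.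
apply: step_lift_hom => [|w c u v]; first exact: tensor_lift_hom.
by rewrite -lP -(homL IH).
Qed.

Let hbase : alghom (tensor_lift jR f : base -> R).
Proof. exact: tensor_lift_hom. Qed.
Let lbr n w :
  linear (fun u : aug_plusT (stage n) => P w (stage_lift (submod_val u))).
Proof. by move=> c u v; rewrite -lP -(homL (stage_lift_hom n)). Qed.

Lemma stage_lift_in n c :
  stage_lift (step_in Omega (stage n) c : stage n.+1) = tensor_lift jR f c.
Proof. exact: (step_lift_in hbase (@lbr n)). Qed.

Lemma stage_lift_bracket n w (u : aug_plusT (stage n)) :
  stage_lift (bracket base w u : stage n.+1) = P w (stage_lift (submod_val u)).
Proof. exact: (step_lift_bracket hbase (@lbr n)). Qed.

(** From stage 1 on, both sides are algebra homomorphisms out of the same step,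
    with the same values on C and, by induction, on brackets. *)
Lemma stage_lift_map n (x : stage n) :
  stage_lift (stage_map Omega A hB n x) = stage_lift x.
Proof.
elim: n x => [|n IH]; first exact: stage_lift_in.
have hup := alghom_comp (aughom_hom (stage_map Omega A hB n.+1))
  (stage_lift_hom n.+2).
apply: (step_ext hup (stage_lift_hom n.+1)) => [c|w u].
  transitivity (stage_lift (step_in Omega (stage n.+1) c : stage n.+2)).
    by congr stage_lift; exact: stage_map_in.
  by rewrite stage_lift_in; exact/esym/stage_lift_in.
transitivity (stage_lift
  (bracket base w (plus_map (stage_map Omega A hB n) u) : stage n.+2)).
  by congr stage_lift; exact: step_map_bracket.
rewrite stage_lift_bracket; apply/esym.
by apply: etrans (stage_lift_bracket w u) _; congr (P w _); exact/esym/IH.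
Qed.

(** The value on a class is read off an arbitrary representative, which is
    legitimate by [stage_lift_map]. *)
Definition frakI_lift (x : I) : R :=
  stage_lift (tagged (repr (x : dirlim (stage_sys Omega A hB)))).

Lemma frakI_liftE n (x : stage n) : frakI_lift (I_incl n x) = stage_lift x.
Proof. exact: (frakI_repr (F := stage_lift) stage_lift_map x). Qed.

Lemma frakI_lift_hom : alghom frakI_lift.
Proof.
split=> [c|].
  apply: frakI_elim2 => n x y.
  by rewrite -(homL (frakI_incl_hom n)) !frakI_liftE (homL (stage_lift_hom n)).
split.
  by rewrite -(hom1 (frakI_incl_hom 0)) frakI_liftE (hom1 (stage_lift_hom 0)).
apply: frakI_elim2 => n x y.
by rewrite -(homM (frakI_incl_hom n)) !frakI_liftE (homM (stage_lift_hom n)).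
Qed.

Lemma frakI_lift_A a : frakI_lift (frakI_A Omega hB a) = jR a.
Proof. by rewrite frakI_liftE [LHS](tensor_liftE hj hf) (hom1 hf) mulr1. Qed.

Lemma frakI_lift_B b : frakI_lift (frakI_B Omega A hB b) = f b.
Proof. by rewrite frakI_liftE [LHS](tensor_liftE hj hf) (hom1 hj) mul1r. Qed.

(** Here both halves of [operated_over] are used: on the A-component of x the
    operator is rho, carried over by jR, and on the I^+-component it is the
    bracket; additivity of P_w recombines the two values. *)
Lemma frakI_lift_Pi w x : frakI_lift (Pi w x) = P w (frakI_lift x).
Proof.
elim/frakI_elim: x => n x; rewrite frakI_PiE frakI_liftE /stage_Pi.
have jE m a : stage_lift (aug_j (stage m) a) = jR a.
  by rewrite -frakI_liftE -frakI_A_incl frakI_lift_A.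
rewrite (linD (homL (stage_lift_hom _))) jE stage_lift_bracket frakI_liftE.
rewrite (linB (homL (stage_lift_hom _))) jE; case: hR => _ [_ ->].
by rewrite -(linD (lP w)) subrKC.
Qed.

Lemma frakI_lift_operated_hom : operated_hom Pi P frakI_lift.
Proof. by split; [exact: frakI_lift_hom | exact: frakI_lift_Pi]. Qed.

End Lift.

(** A and B together with the operators generate I: stage n+1 is generated by C
    and by the brackets of elements of [I_n^+], which are values of Pi. *)
Lemma frakI_ext (R : comAlg k) (P : Omega -> R -> R) (f g : I -> R) :
  operated_hom Pi P f -> operated_hom Pi P g ->
  (forall a, f (frakI_A Omega hB a) = g (frakI_A Omega hB a)) ->
  (forall b, f (frakI_B Omega A hB b) = g (frakI_B Omega A hB b)) -> f =1 g.
Proof.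
move=> [hf fP] [hg gP] fgA fgB; apply: frakI_elim.
have hincl n (e : I -> R) : alghom e -> alghom (e \o I_incl n).
  exact: alghom_comp (frakI_incl_hom n).
have fg0 : (f \o I_incl 0) =1 (g \o I_incl 0).
  have ext := @tensor_ext k A B R _ _ (hincl 0%N _ hf) (hincl 0%N _ hg).
  exact: (ext fgA fgB).
elim=> [|n IH]; first exact: fg0.
have ext := @step_ext k Omega A base (stage n) R _ _ (hincl n.+1 _ hf)
  (hincl n.+1 _ hg).
apply: ext => [c|w u] /=.
  by rewrite frakI_incl_step_in; exact: fg0.
by rewrite -(frakI_Pi_plus _ _ hrho) fP gP IH.
Qed.

End FrakI.

Theorem theorem3p10 (k : fieldType) (hchar : [pchar k]%R =i pred0)
    (Omega : Type) (hOmega : inhabited Omega)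
    (A : comAlg k) (rho : Omega -> A -> A) (hrho : operated rho)
    (B : comAlg k) (Bplus : set B) (hB : augmented Bplus) :
  is_free_over rho (@frakI_Pi k Omega A B Bplus hB rho)
    (@frakI_A k Omega A B Bplus hB) (@frakI_B k Omega A B Bplus hB).
Proof.
split; last first.
- move=> R P jR hR f hf; have hL := frakI_lift_operated_hom hB hR hf.
  exists (frakI_lift (hB := hB) P jR f); split.
    split; last exact: (frakI_lift_B hB hR hf).
    by split=> // a; exact: (frakI_lift_A hB hR hf).
  move=> g [[hg gA] gB]; apply/funext/(frakI_ext hrho hL hg) => [a|b].
    by rewrite gA (frakI_lift_A hB hR hf).
  by rewrite gB (frakI_lift_B hB hR hf).
- exact: frakI_B_hom.
- split; first exact: frakI_Pi_linear.
  by split=> [|w a]; [exact: frakI_A_hom | rewrite frakI_Pi_A].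
Qed.
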